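(* Let $(Q,\mathfrak n,k)$ be a regular local ring, $\mathfrak a\subseteq\mathfrak n^2$ an ideal of $Q$, $R=Q/\mathfrak a$ with maximal ideal $\mathfrak m=\mathfrak n/\mathfrak a$, and $J$ an ideal of $Q$ containing $\mathfrak a$. If $I=J/\mathfrak a$ is a q.c.i. ideal of $R$, then $\nu(J)=\nu(\mathfrak a)+\operatorname{grade}_R(I)$.
   Context: $\nu(M)$ is the minimal number of generators of a finitely generated module. An ideal $I$ of a local ring $R$ with $\nu(I)=n$, minimal generating set $f_1,\dots,f_n$, Koszul complex $E$ on $f_1,\dots,f_n$ and $S=R/I$ is a quasi-complete intersection (q.c.i.) ideal if $\mathrm H_1(E)$ is a free $S$-module and the canonical homomorphism of graded $S$-algebras $\bigwedge^S_* \mathrm H_1(E)\to \mathrm H_*(E)$ is bijective. $\operatorname{grade}_R(I)$ is the maximal length of an $R$-regular sequence in $I$.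
   Formalization: The formal theorem assumes that $J\subseteq\mathfrak n$, i.e. that $I$ is a proper ideal of $R$; for $J=Q$ the formula fails (for example $Q$ a field, $\mathfrak a=0$: $\nu(J)=1$ but $\nu(\mathfrak a)+\operatorname{grade}_R(I)=0$). *)

(* Defs.v *)
From HB Require Import structures.
From mathcomp Require Import all_boot all_order all_algebra.
Set Implicit Arguments. Unset Strict Implicit. Unset Printing Implicit Defensive.
Import Order.TTheory GRing.Theory Num.Theory.
Local Open Scope ring_scope.

Section Defs.
Variable R : comUnitRingType.

Definition is_ideal (I : R -> Prop) : Prop :=
  I 0 /\ (forall x y, I x -> I y -> I (x + y)) /\ (forall r x, I x -> I (r * x)).

Definition generated_by (I : R -> Prop) (n : nat) (f : 'I_n -> R) : Prop :=
  forall x, I x <-> exists c : 'I_n -> R, x = \sum_(i < n) c i * f i.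

Definition nu_is (I : R -> Prop) (n : nat) : Prop :=
  (exists f : 'I_n -> R, generated_by I f) /\
  (forall m (g : 'I_m -> R), generated_by I g -> (n <= m)%N).

Definition noetherian : Prop :=
  forall I, is_ideal I -> exists n (f : 'I_n -> R), generated_by I f.

Definition is_prime (P : R -> Prop) : Prop :=
  is_ideal P /\ ~ P 1 /\ (forall x y, P (x * y) -> P x \/ P y).

Definition local_max (m : R -> Prop) : Prop :=
  is_ideal m /\ (forall x, m x <-> x \notin GRing.unit).

Definition strict_incl (P P' : R -> Prop) : Prop :=
  (forall x, P x -> P' x) /\ exists x, P' x /\ ~ P x.

Definition prime_chain (d : nat) (P : nat -> R -> Prop) : Prop :=
  (forall i, (i <= d)%N -> is_prime (P i)) /\
  (forall i, (i < d)%N -> strict_incl (P i) (P i.+1)).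

Definition krull_dim_is (d : nat) : Prop :=
  (exists P, prime_chain d P) /\ (forall e P, prime_chain e P -> (e <= d)%N).

Definition regular_local (m : R -> Prop) : Prop :=
  noetherian /\ local_max m /\ exists d, krull_dim_is d /\ nu_is m d.

Definition ideal_sq (m : R -> Prop) (x : R) : Prop :=
  exists k (u v : 'I_k -> R), (forall i, m (u i) /\ m (v i)) /\
    x = \sum_(i < k) u i * v i.

Definition in_prefix_ideal (m : nat) (x : 'I_m -> R) (k : nat) (y : R) : Prop :=
  exists c : 'I_m -> R, y = \sum_(j < m | (j < k)%N) c j * x j.

Definition regular_seq (m : nat) (x : 'I_m -> R) : Prop :=
  (forall i : 'I_m, forall y, in_prefix_ideal x i (x i * y) -> in_prefix_ideal x i y) /\
  ~ in_prefix_ideal x m 1.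

Definition grade_is (I : R -> Prop) (g : nat) : Prop :=
  (exists x : 'I_g -> R, (forall i, I (x i)) /\ regular_seq x) /\
  (forall m (x : 'I_m -> R), (forall i, I (x i)) -> regular_seq x -> (m <= g)%N).

(* Koszul complex on f : 'I_n -> R: the exterior algebra on e_1..e_n,
   an element is a function {set 'I_n} -> R (coefficient of e_U). *)
Variable n : nat.
Variable f : 'I_n -> R.

Definition kelt := {set 'I_n} -> R.

Definition kdeg (i : nat) (x : kelt) : Prop := forall U : {set 'I_n}, #|U| != i -> x U = 0.

Definition ksign (A B : {set 'I_n}) : R :=
  (-1) ^+ #|[set p : 'I_n * 'I_n | (p.1 \in A) && (p.2 \in B) && (p.2 < p.1)%N]|.

Definition kmul (x y : kelt) : kelt := fun U =>
  \sum_(A : {set 'I_n} | A \subset U) ksign A (U :\: A) * x A * y (U :\: A).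

Definition kone : kelt := fun U => if U == set0 then 1 else 0.

Definition kdiff (x : kelt) : kelt := fun U =>
  \sum_(j : 'I_n | j \notin U) (-1) ^+ #|[set u in U | (u < j)%N]| * f j * x (j |: U).

Definition kcycle (i : nat) (z : kelt) : Prop := kdeg i z /\ forall U, kdiff z U = 0.

Definition kboundary (i : nat) (z : kelt) : Prop :=
  exists y, kdeg i.+1 y /\ forall U, z U = kdiff y U.

Definition kprod (r : nat) (z : 'I_r -> kelt) (U : {set 'I_r}) : kelt :=
  foldr (fun j acc => kmul (z j) acc) kone (enum U).

Definition kcomb (r i : nat) (z : 'I_r -> kelt) (s : {set 'I_r} -> R) : kelt :=
  fun V => \sum_(U : {set 'I_r} | #|U| == i) s U * kprod z U V.

End Defs.

(* q.c.i. ideal: for a minimal generating set f of I, H_1(E) is a free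
   S = R/I-module (basis the classes of cycles z_1..z_r) and the canonical
   map /\_S H_1(E) -> H(E) is bijective, i.e. for every i the classes of the
   products z_U (|U| = i) form an S-basis of H_i(E). *)
Definition qci (R : comUnitRingType) (I : R -> Prop) : Prop :=
  exists n (f : 'I_n -> R), generated_by I f /\ nu_is I n /\
  exists r (z : 'I_r -> kelt R n),
    (forall j, kcycle f 1 (z j)) /\
    forall i : nat,
      (forall c, kcycle f i c ->
         exists s : {set 'I_r} -> R,
           kboundary f i (fun V => c V - kcomb i z s V)) /\
      (forall s : {set 'I_r} -> R, kboundary f i (kcomb i z s) ->
         forall U : {set 'I_r}, #|U| = i -> I (s U)).

Definition img (Q R : comUnitRingType) (pi : Q -> R) (J : Q -> Prop) : R -> Prop :=
  fun y => exists x, J x /\ pi x = y.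

(* Main.v *)
From Stdlib Require Import List.
Require Import Defs.
From HB Require Import structures.
From mathcomp Require Import all_boot all_order all_algebra.
From mathcomp Require Import boolp.
From mathcomp Require Import ring zify.
Set Implicit Arguments. Unset Strict Implicit. Unset Printing Implicit Defensive.
Import GRing.Theory.
Local Open Scope ring_scope.

(** Let f be a minimal generating set of I, of size n, E its Koszul complex and z_1, ..., z_r
   cycles giving a basis of H_1(E).  By depth sensitivity of the Koszul complex the top
   nonvanishing homology of E is in degree n - grade I; it is also in degree r, so
   grade I = n - r.  Lift f and the coefficients of the z_j to Q and let s_j in a be the value
   at f of the lift of z_j.  The point is that the s_j are linearly independent in a / na:
   they then extend to a minimal generating set s, t of a, and f, t is a minimal
   generating set of J.

   Suppose z = sum u_j z_j with some u_j a unit and sum u_j s_j in na.  Because the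
   Koszul complex of Q on generators x of n is exact in degree 1, z becomes a boundary in
   the Koszul complex of R on f, x.  On the other hand multiplication by z is exact on
   H(E) = /\ H_1(E), so adjoining to E one divided power variable w with dw = z gives a
   complex E<w> with bounded homology, and tensoring with the Koszul complex on x keeps it
   bounded.  Since z is now a boundary, a change of variables makes w a cycle, and its
   divided powers give nonzero classes in arbitrarily high degree: contradiction. *)

(** If t has p elements, the counts are nu(a) = r + p and nu(J) = n + p, while grade I = n - r.
    Minimality of f, t comes from H_1: a relation modulo nJ yields, after a correction with
    coefficients in n, a vector e with sum e_i f_i in a. So e is a combination of the z_j, plus a
    boundary, plus a vector with entries in a. A lifted boundary takes the value 0 at f already in
    Q, hence sum e_i f_i is a combination of the s_j modulo na, and independence of s, t applies.

    The unit among the u_j makes multiplication by z exact, and exactness bounds the homology by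
    clearing the highest power of w again and again. The change of variables in w is made one
    summand a e_p e_q at a time; each has square zero, so no divided powers of a general element of
    degree two occur.

    Regularity is given through Krull dimension, whereas the argument needs the Koszul complex on
    generators of n to be exact in degree 1; the bridge is Krull's principal ideal theorem.
    Quotients and localisations are not formed: statements about R/A are made relative to an ideal
    A, and localising at P becomes multiplying by elements outside P. *)

Section Ideals.
Variable R : comUnitRingType.
Implicit Types (A B I P : R -> Prop).

(** * Ideals as predicates, the maximal condition, Nakayama at a prime *)

Definition incl A B := forall x, A x -> B x.

Lemma ideal0 A : is_ideal A -> A 0. Proof. by case. Qed.
Lemma idealD A x y : is_ideal A -> A x -> A y -> A (x + y).
Proof. by case=> _ [+ _]; apply. Qed.
Lemma idealMl A r x : is_ideal A -> A x -> A (r * x).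
Proof. by case=> _ [_]; apply. Qed.
Lemma idealMr A r x : is_ideal A -> A x -> A (x * r).
Proof. by rewrite mulrC; apply: idealMl. Qed.
Lemma idealN A x : is_ideal A -> A x -> A (- x).
Proof. by move=> hA hx; rewrite -mulN1r; apply: idealMl. Qed.
Lemma idealB A x y : is_ideal A -> A x -> A y -> A (x - y).
Proof. by move=> hA hx hy; apply: idealD => //; apply: idealN. Qed.
Lemma ideal_sum A (T : Type) (s : seq T) (Q : pred T) (F : T -> R) :
  is_ideal A -> (forall i, Q i -> A (F i)) -> A (\sum_(i <- s | Q i) F i).
Proof.
move=> hA hF; apply: (big_ind A) => //; first exact: ideal0.
by move=> x y; apply: idealD.
Qed.
Lemma idealBK A x y : is_ideal A -> A (x - y) -> A y -> A x.
Proof. by move=> hA h1 h2; rewrite -(subrK y x); apply: idealD. Qed.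

Definition span n (g : 'I_n -> R) : R -> Prop :=
  fun x => exists c : 'I_n -> R, x = \sum_(i < n) c i * g i.

Lemma span_ideal n (g : 'I_n -> R) : is_ideal (span g).
Proof.
split; [|split].
- by exists (fun=> 0); rewrite big1 // => i _; rewrite mul0r.
- move=> _ _ [c ->] [d ->]; exists (fun i => c i + d i).
  by rewrite -big_split; apply: eq_bigr => i _; rewrite mulrDl.
- move=> r _ [c ->]; exists (fun i => r * c i).
  by rewrite big_distrr; apply: eq_bigr => i _; rewrite /= mulrA.
Qed.

Lemma span_mem n (g : 'I_n -> R) i : span g (g i).
Proof.
exists (fun j => (j == i)%:R); rewrite (bigD1 i) //= eqxx mul1r big1 ?addr0 //.
by move=> j /negPf->; rewrite mul0r.
Qed.

Lemma span_incl n (g : 'I_n -> R) A :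
  is_ideal A -> (forall i, A (g i)) -> incl (span g) A.
Proof. by move=> hA hg _ [c ->]; apply: ideal_sum => // i _; apply: idealMl. Qed.

Lemma generatedP I n (g : 'I_n -> R) :
  is_ideal I -> (forall i, I (g i)) -> incl I (span g) -> generated_by I g.
Proof. by move=> hI hg hs x; split=> [/hs//|]; apply: span_incl. Qed.

Lemma generated_mem I n (g : 'I_n -> R) i : generated_by I g -> I (g i).
Proof. by move=> h; apply/h/span_mem. Qed.

Definition iadd A B : R -> Prop := fun x => exists a b, [/\ A a, B b & x = a + b].

Lemma iadd_ideal A B : is_ideal A -> is_ideal B -> is_ideal (iadd A B).
Proof.
move=> hA hB; split; [|split].
- by exists 0, 0; split; [exact: ideal0|exact: ideal0|rewrite addr0].
- move=> _ _ [a [b [ha hb ->]]] [a' [b' [ha' hb' ->]]].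
  exists (a + a'), (b + b'); split; [exact: idealD|exact: idealD|].
  by rewrite addrACA.
- move=> r _ [a [b [ha hb ->]]]; exists (r * a), (r * b).
  by rewrite mulrDr; split=> //; apply: idealMl.
Qed.

Lemma iaddl A B : is_ideal B -> incl A (iadd A B).
Proof. by move=> hB x hx; exists x, 0; split=> //; [exact: ideal0|rewrite addr0]. Qed.
Lemma iaddr A B : is_ideal A -> incl B (iadd A B).
Proof. by move=> hB x hx; exists 0, x; split=> //; [exact: ideal0|rewrite add0r]. Qed.
Lemma iadd_incl A B I : is_ideal I -> incl A I -> incl B I -> incl (iadd A B) I.
Proof. by move=> hI hA hB _ [a [b [/hA ha /hB hb ->]]]; apply: idealD. Qed.

Definition princ (y : R) : R -> Prop := fun x => exists r, x = r * y.
Lemma princ_ideal y : is_ideal (princ y).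
Proof.
split; [by exists 0; rewrite mul0r|split].
  by move=> _ _ [r ->] [s ->]; exists (r + s); rewrite mulrDl.
by move=> r _ [s ->]; exists (r * s); rewrite mulrA.
Qed.
Lemma princ_mem y : princ y y. Proof. by exists 1; rewrite mul1r. Qed.
Lemma princ_incl y I : is_ideal I -> I y -> incl (princ y) I.
Proof. by move=> hI hy _ [r ->]; apply: idealMl. Qed.

Definition adj A y := iadd A (princ y).
Lemma adj_ideal A y : is_ideal A -> is_ideal (adj A y).
Proof. by move=> hA; apply: iadd_ideal => //; apply: princ_ideal. Qed.
Lemma adj_l A y : incl A (adj A y). Proof. exact/iaddl/princ_ideal. Qed.
Lemma adj_r A y : is_ideal A -> adj A y y.
Proof. by move=> hA; apply: iaddr => //; apply: princ_mem. Qed.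
Lemma adj_incl A y I : is_ideal I -> incl A I -> I y -> incl (adj A y) I.
Proof. by move=> hI hA hy; apply: iadd_incl => //; apply: princ_incl. Qed.
Lemma adjP A y x : adj A y x <-> exists r, A (x - r * y).
Proof.
split=> [[a [_ [ha [r ->] ->]]]|[r hr]]; first by exists r; rewrite addrK.
by exists (x - r * y), (r * y); split=> //; [exists r|rewrite subrK].
Qed.

Lemma noetherian_max (F : (R -> Prop) -> Prop) :
  noetherian R -> (exists A, F A) -> (forall A, F A -> is_ideal A) ->
  exists A, F A /\ forall B, F B -> incl A B -> incl B A.
Proof.
move=> hN [A0 hA0] hF; apply: contrapT => hno.
have step (S : {A | F A}) : exists T : {A | F A},
    incl (sval S) (sval T) /\ exists x, sval T x /\ ~ sval S x.
  apply: contrapT => hS; apply: hno; exists (sval S); split; first exact: (svalP S).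
  move=> B hB hSB x hx; apply: contrapT => hSx; apply: hS.
  by exists (exist _ B hB); split=> //; exists x.
have [nxt hnxt] := choice step.
pose S k := sval (iter k nxt (exist _ A0 hA0)).
have SS k : incl (S k) (S k.+1) by have [] := hnxt (iter k nxt (exist _ A0 hA0)).
have Smono k l : (k <= l)%N -> incl (S k) (S l).
  move=> /subnK <-; elim: (l - k)%N => // p IH x /IH; exact: SS.
have SI k : is_ideal (S k) by apply: hF; exact: svalP.
pose U x := exists k, S k x.
have hU : is_ideal U.
  split; [by exists 0%N; apply: ideal0|split].
    move=> x y [k hk] [l hl]; exists (maxn k l); apply: idealD => //.
      exact: (Smono k _ (leq_maxl _ _)).
    exact: (Smono l _ (leq_maxr _ _)).
  by move=> r x [k hk]; exists k; apply: idealMl.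
have [n [g hg]] := hN U hU.
have ex i : exists k, S k (g i) := generated_mem i hg.
have [k hk] := choice ex.
pose m := (\max_i k i)%N.
have [_ [x [hx hnx]]] := hnxt (iter m nxt (exist _ A0 hA0)).
apply: hnx; have /hg hs : U x by exists m.+1.
apply: (span_incl _ _ hs); first exact: SI.
by move=> i; apply: (Smono (k i)) => //; apply: leq_bigmax.
Qed.

Definition colon A (y : R) : R -> Prop := fun x => A (x * y).
Lemma colon_ideal A y : is_ideal A -> is_ideal (colon A y).
Proof.
move=> hA; rewrite /colon; split; [by rewrite mul0r; apply: ideal0|split].
  by move=> u v hu hv; rewrite mulrDl; apply: idealD.
by move=> r u hu; rewrite -mulrA; apply: idealMl.
Qed.

(** Annihilators of nonzero classes of [R/A] that are maximal are prime. Starting from those above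
    the annihilator of [w] places such a prime over it; the last clause records maximality among all
    classes, as used in [common_annihilator]. *)
Lemma max_annihilator A w :
  noetherian R -> is_ideal A -> ~ A w ->
  exists y, [/\ ~ A y, incl (colon A w) (colon A y), is_prime (colon A y) &
    forall v, ~ A v -> incl (colon A y) (colon A v) -> incl (colon A v) (colon A y)].
Proof.
move=> hN hA hw.
have [|_ [y [hy hwy ->]]|_ [[y [hy hwy ->]] hmax]] := @noetherian_max
  (fun B => exists y, [/\ ~ A y, incl (colon A w) (colon A y) & B = colon A y]) hN.
- by exists (colon A w), w; split.
- exact: colon_ideal.
exists y; have hmx v : ~ A v -> incl (colon A y) (colon A v) ->
    incl (colon A v) (colon A y).
  by move=> hv hyv; apply: hmax => //; exists v; split=> // x /hwy/hyv.
split=> //; split; [exact: colon_ideal|split; first by rewrite /colon mul1r].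
move=> u v huv; have [hv|hv] := EM (A (v * y)); [by right|left].
apply: (hmx (v * y)) => //; last by rewrite /colon mulrA.
by move=> x hx; rewrite /colon mulrCA; apply: idealMl.
Qed.

Lemma prime_ideal P : is_prime P -> is_ideal P. Proof. by case. Qed.
Lemma primeM P x y : is_prime P -> ~ P x -> ~ P y -> ~ P (x * y).
Proof. by case=> _ [_ h] hx hy /h []. Qed.
Lemma primeMl P x y : is_prime P -> ~ P x -> P (x * y) -> P y.
Proof. by case=> _ [_ h] hx /h []. Qed.
Lemma prime1 P : is_prime P -> ~ P 1. Proof. by case=> _ []. Qed.
Lemma primeX P x k : is_prime P -> P (x ^+ k) -> P x.
Proof.
move=> hP; elim: k => [|k IH]; first by rewrite expr0 => /(prime1 hP).
by rewrite exprS; case: hP => _ [_ h] /h [].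
Qed.

(** Nakayama for the localisation at [P], by eliminating one generator at a time. When [P] is the
    maximal ideal, [s] is a unit and the usual form results. *)
Lemma nakayama_prime P A m (g : 'I_m -> R) :
  is_prime P -> is_ideal A ->
  (forall i, exists s (p : 'I_m -> R),
     [/\ ~ P s, forall j, P (p j) & A (s * g i - \sum_j p j * g j)]) ->
  exists2 s, ~ P s & forall i, A (s * g i).
Proof.
move=> hP hA; have hPi := prime_ideal hP.
elim: m g => [|m IH] g hg; first by exists 1; [exact: prime1|case].
have [s [p [hs hp hA0]]] := hg ord_max.
rewrite big_ord_recr /= in hA0.
pose w (i : 'I_m) := widen_ord (leqnSn m) i.
set b := \sum_(i < m) _ in hA0.
(* The pivot lies outside [P]; multiplying the other relations by it eliminates the last
   generator. *)
pose sg := s - p ord_max.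
have hsg : ~ P sg by move=> h; apply: hs; apply: (idealBK hPi h).
have hA1 : A (sg * g ord_max - b).
  by rewrite (_ : _ - b = s * g ord_max - (b + p ord_max * g ord_max)) // /sg; ring.
have [i|s' hs' hA'] := IH (fun i => g (w i)).
  have [t [q [ht hq hA2]]] := hg (w i).
  exists (sg * t), (fun j => sg * q (w j) + q ord_max * p (w j)); split.
  - exact: primeM.
  - by move=> j; apply: idealD => //; apply: idealMl.
  rewrite big_ord_recr /= in hA2.
  have := idealD hA (idealMl sg hA hA2) (idealMl (q ord_max) hA hA1).
  congr (A _); rewrite /b (eq_bigr _ (fun j _ => mulrDl _ _ (g (w j)))).
  rewrite big_split /= !mulrBr !mulrDr.
  rewrite !(big_distrr) /= -/w.
  under [in RHS]eq_bigr do rewrite -mulrA.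
  under [X in _ = _ - (_ + X)]eq_bigr do rewrite -mulrA.
  ring.
exists (s' * sg); first exact: primeM.
move=> i; case: (unliftP ord_max i) => [j|] ->.
  rewrite (_ : lift _ j = w j); last by apply: val_inj; rewrite /= /bump leqNgt ltn_ord.
  by rewrite mulrAC; apply: idealMr.
rewrite -mulrA -(subrK (b) (sg * _)) mulrDr; apply: idealD => //; first exact: idealMl.
rewrite big_distrr; apply: ideal_sum => // j _ /=.
by rewrite mulrCA; apply: idealMl.
Qed.

(** * Krull's principal ideal theorem *)

(** The contraction to [R] of the extension of [A] to the localisation at [P]. *)
Definition sat P A : R -> Prop := fun x => exists2 s, ~ P s & A (s * x).

Lemma sat_ideal P A : is_prime P -> is_ideal A -> is_ideal (sat P A).
Proof.
move=> hP hA; split; [|split].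
- by exists 1; [exact: prime1|rewrite mulr0; apply: ideal0].
- move=> x y [s hs hx] [t ht hy]; exists (s * t); first exact: primeM.
  by rewrite mulrDr; apply: idealD => //; [rewrite mulrAC|rewrite -mulrA];
     [apply: idealMr|apply: idealMl].
- by move=> r x [s hs hx]; exists s => //; rewrite mulrCA; apply: idealMl.
Qed.

Lemma sat_closed P A x s : is_prime P -> ~ P s -> sat P A (s * x) -> sat P A x.
Proof.
by move=> hP hs [t ht]; rewrite mulrA => h; exists (t * s) => //; apply: primeM.
Qed.

Lemma sat_l P A : is_prime P -> incl A (sat P A).
Proof. by move=> hP x hx; exists 1; rewrite ?mul1r //; apply: prime1. Qed.

(* If P is the only prime between X and P then R_P / X R_P is artinian. *)
Lemma saturated_chain_stable P X (C : nat -> R -> Prop) :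
  noetherian R -> is_prime P -> is_ideal X -> incl X P ->
  (forall P', is_prime P' -> incl X P' -> incl P' P -> incl P P') ->
  (forall k, is_ideal (C k)) -> (forall k, incl X (C k)) ->
  (forall k, incl (C k.+1) (C k)) ->
  (forall k s x, ~ P s -> C k (s * x) -> C k x) ->
  exists k, incl (C k) (C k.+1).
Proof.
move=> hN hP hX hXP hmin hC hXC hdec hsat.
(* [St B]: the chain stabilises inside [B]. Enlarging [B] takes the place of a composition series; a
   maximal [B] has to contain 1. *)
pose St B := exists k0, forall k, (k0 <= k)%N ->
  forall x, B x -> C k x -> C k.+1 x.
have hCmono k l : (k <= l)%N -> incl (C l) (C k).
  by move=> /subnK <-; elim: (l - k)%N => // p IH x hx; apply/IH/hdec.
have [||B [[hBi hXB [k0 hB]] hmax]] := @noetherian_max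
    (fun B => [/\ is_ideal B, incl X B & St B]) hN.
- by exists X; split=> //; exists 0%N => k _ x hx _; apply: hXC.
- by move=> A [].
suff h1 : B 1.
  by exists k0 => x hx; apply: hB => //; rewrite -(mulr1 x); apply: idealMl.
apply: contrapT => h1.
have [y [hy _ hpr _]] := max_annihilator hN hBi h1.
apply: hy; apply: hmax (adj_r _ hBi); last exact: adj_l.
split; [exact: adj_ideal|by move=> x /hXB; apply: adj_l|].
have [[s [hs hsP]]|hall] := EM (exists s, colon B y s /\ ~ P s).
  exists k0 => k hk x /adjP [r hr] hx; apply: (hsat _ s) => //.
  apply: hB => //; last exact: idealMl.
  rewrite -(subrK (r * y) x) mulrDr; apply: idealD => //; first exact: idealMl.
  by rewrite mulrCA; apply: idealMl.
have hPy : incl P (colon B y).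
  apply: hmin => //.
    by move=> x hx; apply: idealMr => //; apply: hXB.
  by move=> x hx; apply: contrapT => hPx; apply: hall; exists x.
have key r x : B (x - r * y) -> P r -> B x.
  by move=> h1' /hPy; apply: idealBK h1'.
(* Now [colon B y] equals [P], so the layer added by [y] is a copy of [R/P]. Either the chain
   eventually misses it, or each [C k.+1] has an [x'] congruent to [r' * y] with [r'] outside [P];
   then [r' * x] and [r * x'] agree modulo [B]. *)
have [[k1 hk1]|hno] := EM (exists k1, forall x, adj B y x -> C k1 x -> B x).
  exists (maxn k0 k1) => k; rewrite geq_max => /andP[hk hk'] x hx hCx.
  by apply: hB => //; apply: hk1 => //; apply: hCmono hCx.
exists k0 => k hk x /adjP [r hr] hx.
have [x' [/adjP [r' hr'] hx' hBx']] : exists x', [/\ adj B y x', C k.+1 x' & ~ B x'].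
  apply: contrapT => hn; apply: hno; exists k.+1 => z hz hz'.
  by apply: contrapT => hBz; apply: hn; exists z.
have hPr' : ~ P r' by move=> /(key _ _ hr').
apply: (hsat _ r') => //.
apply: (@idealBK _ _ (r * x')) => //; last exact: idealMl.
apply: hB => //; last by apply: idealB => //; apply: idealMl => //; apply: hdec.
have := idealB hBi (idealMl r' hBi hr) (idealMl r hBi hr').
by congr B; ring.
Qed.

(** Krull's theorem in exchange form. If no prime strictly between [P0] and [P2] contained [x], then
    [P2] would be minimal over [P0] and [x], which forces descending chains modulo [x] to stop. *)
Lemma principal_ideal_theorem P0 P1 P2 x :
  noetherian R -> is_prime P0 -> is_prime P1 -> is_prime P2 ->
  strict_incl P0 P1 -> strict_incl P1 P2 -> P2 x ->
  exists P', [/\ is_prime P', P' x, strict_incl P0 P' & strict_incl P' P2].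
Proof.
move=> hN h0 h1 h2 h01 h12 hx.
have [hx1|hx1] := EM (P1 x); first by exists P1; split.
apply: contrapT => hno.
have [i0 i1 i2] : [/\ is_ideal P0, is_ideal P1 & is_ideal P2] by split; apply: prime_ideal.
have hx0 : ~ P0 x by move=> /h01.1.
pose X := adj P0 x.
have hX : is_ideal X by apply: adj_ideal.
have hX2 : incl X P2 by apply: adj_incl => // u /h01.1 /h12.1.
have hmin P' : is_prime P' -> incl X P' -> incl P' P2 -> incl P2 P'.
  move=> hP' hXP' hP'2 u hu; apply: contrapT => hnu; apply: hno; exists P'; split=> //.
  - exact/hXP'/adj_r.
  - by split; [move=> v hv; apply/hXP'/adj_l|exists x; split=> //; apply/hXP'/adj_r].
  - by split=> //; exists u.
have [_ [y [hy hy0]]] := h01.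
(* Powers of a single [y], contracted from the localisation at [P1], stand in for symbolic powers of
   [P1]; in the domain [R/P0] the factor [y ^+ k] can be cancelled at the end. *)
pose A k := sat P1 (adj P0 (y ^+ k)).
have hA k : is_ideal (A k) by apply: sat_ideal => //; apply: adj_ideal.
have hP0A k : incl P0 (A k) by move=> u hu; apply: (sat_l h1); apply: adj_l.
have hAdec k : incl (A k.+1) (A k).
  move=> u [s hs hu]; exists s => //; move: hu; apply: adj_incl => //.
  - exact: adj_ideal.
  - exact: adj_l.
  - by rewrite exprS; apply: idealMl (adj_r _ _) => //; apply: adj_ideal.
pose C k := sat P2 (adj (A k) x).
have hC k : is_ideal (C k) by apply: sat_ideal => //; apply: adj_ideal.
have [||k u s hs|k hk] := @saturated_chain_stable P2 X C hN h2 hX hX2 hmin hC.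
- move=> k u hu; apply: sat_l => //; move: hu; apply: adj_incl.
  + exact: adj_ideal.
  + by move=> v /(hP0A k); apply: adj_l.
  + exact: adj_r.
- move=> k u [s hs hu]; exists s => //; move: hu; apply: adj_incl.
  + exact: adj_ideal.
  + by move=> v /(hAdec k); apply: adj_l.
  + exact: adj_r.
- exact: sat_closed.
have [n [g hg]] := hN _ (hA k).
(* Stability modulo [x] puts [A k] inside [A k.+1 + x A k] up to factors outside [P2]: the cofactor
   [q] of [x] is in [A k] because [x] is outside [P1]. *)
have [i|t ht htA] := @nakayama_prime P2 (A k.+1) n g h2 (hA k.+1).
  have hgi := generated_mem i hg.
  have [s hs /adjP [q hq]] : C k.+1 (g i) by apply/hk/sat_l => //; apply: adj_l.
  have /hg [c hc] : A k q.
    apply: (@sat_closed _ _ _ x) => //; rewrite mulrC.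
    rewrite -(subKr (s * g i) (q * x)); apply: (idealB (hA k)).
      exact: (idealMl _ (hA k)).
    exact: hAdec.
  exists s, (fun j => c j * x); split=> //; first by move=> j; apply: idealMl.
  move: hq; rewrite hc big_distrl /=.
  by under eq_bigr do rewrite mulrAC.
have : A k.+1 (y ^+ k).
  have /hg [c ->] : A k (y ^+ k) by apply: sat_l => //; apply: adj_r.
  apply: ideal_sum => // i _; apply: (idealMl _ (hA k.+1)).
  by apply: (@sat_closed _ _ _ t h1); [move=> /h12.1|exact: htA].
move=> [s hs /adjP [r hr]]; apply: hy0; apply: (@primeX _ _ k) => //.
apply: (@primeMl _ (s - r * y)) => //.
  by move=> /h01.1 h; apply: hs; apply: (idealBK i1 h); apply: idealMl.
by move: hr; congr P0; rewrite exprS; ring.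
Qed.

End Ideals.

(** The zero diagonal is a separate hypothesis because antisymmetry does not give it in
    characteristic 2. *)
Lemma big_alternating (R : comUnitRingType) (V : lmodType R) (T : finType) (F : T -> T -> V) :
  (forall i, F i i = 0) -> (forall i j, F i j = - F j i) -> \sum_i \sum_j F i j = 0.
Proof.
move=> h0 hN; rewrite pair_big /=.
rewrite (bigID (fun p : T * T => enum_rank p.1 < enum_rank p.2)%N) /=.
rewrite [X in _ + X](bigID (fun p : T * T => p.1 == p.2)) /=.
rewrite [X in _ + (X + _)]big1 ?add0r; last by case=> i j /= /andP [_ /eqP->].
rewrite [X in _ + X](reindex_inj (h := fun p : T * T => (p.2, p.1))) /=; last first.
  by move=> [a b] [c e] [-> ->].
rewrite [X in _ + X](eq_bigl (fun p : T * T => enum_rank p.1 < enum_rank p.2)%N).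
  by rewrite -big_split big1 //= => -[i j] /= _; rewrite (hN j i) subrr.
move=> [i j] /=; rewrite -leqNgt andbC [RHS]ltn_neqAle.
by rewrite (inj_eq val_inj) (inj_eq enum_rank_inj) eq_sym.
Qed.

Lemma In_cat T (x : T) l1 l2 : In x (l1 ++ l2)%SEQ <-> In x l1 \/ In x l2.
Proof. exact: (in_app_iff l1 l2 x). Qed.

(** * Chains of primes, prime avoidance, zero divisors *)

Section Primes.
Variable R : comUnitRingType.
Implicit Types (A B I P : R -> Prop) (L : list (R -> Prop)).

(** The principal ideal theorem exchanges one prime after another from the top down until all
    contain [y], at the cost of one step: killing [y] lowers the dimension by at most one. *)
Lemma chain_slide (y : R) e (P : nat -> R -> Prop) :
  noetherian R -> prime_chain e.+1 P -> P e.+1 y ->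
  exists P' : nat -> R -> Prop, [/\ prime_chain e P', forall x, P' e x <-> P e.+1 x,
                 incl (P 0%N) (P' 0%N) & P' 0%N y].
Proof.
move=> hN; elim: e P => [|e IH] P [hpr hst] hy.
  exists (fun=> P 1%N); split=> //; first by split=> // i _; apply: hpr.
  exact: (hst 0%N isT).1.
have [] := @principal_ideal_theorem R (P e) (P e.+1) (P e.+2) y hN.
- by apply: hpr; rewrite -addn2 leq_addr.
- exact: hpr.
- exact: hpr.
- by apply: hst; rewrite ltnS leqnSn.
- exact: hst.
- exact: hy.
move=> P' [hP' hP'y heP' hP'e].
have [||P'' [[h1 h2] h3 h4 h5]] := IH (fun i => if (i <= e)%N then P i else P').
- split=> i hi /=; first by case: leqP => // hi'; apply: hpr; do 2 apply: leqW.
  move: hi; rewrite ltnS; case: (ltngtP i e) => // [hi _|-> _] //.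
  by apply: hst; do 2 apply: leqW.
- by rewrite ltnn.
rewrite ltnn /= in h3 h4.
exists (fun i => if (i <= e)%N then P'' i else P e.+2); split=> //; last by rewrite ltnn.
split=> i hi /=; first by case: leqP => // hi'; [exact: h1|exact: hpr].
move: hi; rewrite ltnS; case: (ltngtP i e) => // [hi _|-> _]; first exact: h2.
split=> [x /h3 /hP'e.1 //|].
by have [_ [x [hx1 hx2]]] := hP'e; exists x; split=> // /h3.
Qed.

(** A largest counterexample is not prime, and a prime containing [x * y] contains [x] or [y], so
    the lists of two larger ideals can be joined. The list may also hold primes that are not
    minimal. *)
Lemma finite_minimal_primes A : noetherian R -> is_ideal A ->
  exists L, (forall P, In P L -> is_prime P /\ incl A P) /\
    forall P, is_prime P -> incl A P -> exists2 P', In P' L & incl P' P.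
Proof.
move=> hN hA; apply: contrapT => hno.
have [|_ []//|{hA hno}A [[hA hno] hmax]] := @noetherian_max R
  (fun A => is_ideal A /\ ~ exists L, (forall P, In P L -> is_prime P /\ incl A P) /\
    forall P, is_prime P -> incl A P -> exists2 P', In P' L & incl P' P) hN.
  by exists A; split.
apply: hno.
have [h1|h1] := EM (A 1).
  by exists nil; split=> // P hP hAP; case: (prime1 hP (hAP _ h1)).
have [hp|hnp] := EM (is_prime A).
  exists (A :: nil); split=> [P [<-|//]|P hP hAP]; first by split.
  by exists A; [left|].
have [x [y [hxy hx hy]]] : exists x y, [/\ A (x * y), ~ A x & ~ A y].
  apply: contrapT => hn; apply: hnp; split=> //; split=> // x y hxy.
  have [|hx] := EM (A x); first by left.
  by right; apply: contrapT => hy; apply: hn; exists x, y.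
have ext z : ~ A z -> exists L,
    (forall P, In P L -> is_prime P /\ incl (adj A z) P) /\
    forall P, is_prime P -> incl (adj A z) P -> exists2 P', In P' L & incl P' P.
  move=> hz; apply: contrapT => hn; apply: hz.
  apply: (hmax (adj A z)); [|exact: adj_l|exact: adj_r].
  by split=> //; apply: adj_ideal.
have [Lx [hx1 hx2]] := ext x hx; have [Ly [hy1 hy2]] := ext y hy.
exists (Lx ++ Ly); split=> P.
  by move=> /In_cat [/hx1|/hy1] [hP hAP]; split=> // z hz; apply/hAP/adj_l.
move=> hP hAP; have hPi := prime_ideal hP.
have [hPz|hPz] := hP.2.2 _ _ (hAP _ hxy).
  have [|P' h1' h2'] := hx2 P hP; first exact: adj_incl.
  by exists P' => //; apply/In_cat; left.
have [|P' h1' h2'] := hy2 P hP; first exact: adj_incl.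
by exists P' => //; apply/In_cat; right.
Qed.

Lemma avoid_product P I L : is_prime P -> is_ideal I -> ~ incl I P ->
  (forall P', In P' L -> is_ideal P' /\ ~ incl P' P) ->
  exists w, [/\ I w, ~ P w & forall P', In P' L -> P' w].
Proof.
move=> hP hI hIP; elim: L => [|P' L IH] hL.
  by have /existsNP [w /not_implyP [h1 h2]] := hIP; exists w.
have [|w [h1 h2 h3]] := IH; first by move=> P'' h; apply: hL; right.
have [hP' /existsNP [v /not_implyP [h4 h5]]] := hL P' (or_introl erefl).
exists (v * w); split; [exact: idealMl|exact: primeM|].
move=> P'' [<-|h]; first exact: idealMr.
by apply: idealMl; [apply: (hL _ (or_intror h)).1|apply: h3].
Qed.

(* Besides the primes of L one further set N, stable under adding elements of M, is avoided. *)
Lemma prime_avoidance I M (N : R -> Prop) L : is_ideal I -> is_ideal M ->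
  (forall y w, ~ N y -> M w -> ~ N (y + w)) -> (exists2 y, I y & ~ N y) ->
  (forall P, In P L -> [/\ is_prime P, ~ incl I P & ~ incl M P]) ->
  exists y, [/\ I y, ~ N y & forall P, In P L -> ~ P y].
Proof.
move=> hI hM hNM [y0 hy0 hy0N].
have [k] := ubnP (size L); elim: k L => // k IH [|P L] hk hL; first by exists y0.
have [[P' hP' hP'P]|hnot] := EM (exists2 P', In P' L & incl P' P).
  have [l1 [l2 hl]] : exists l1 l2, L = l1 ++ P' :: l2 by apply: (in_split P').
  have [||y [h1 h2 h3]] := IH (P :: (l1 ++ l2)).
  - by move: hk; rewrite hl /= !size_cat /= addnS ltnS.
  - move=> P'' [<-|/In_cat h]; first by apply: hL; left.
    by apply: hL; right; rewrite hl; apply/In_cat; case: h; [left|right; right].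
  exists y; split=> // P'' [<-|]; first by apply: h3; left.
  rewrite hl => /In_cat [h|[<-|h]]; [|by move=> /hP'P; apply: h3; left|].
    by apply: h3; right; apply/In_cat; left.
  by apply: h3; right; apply/In_cat; right.
have [||y [h1 h2 h3]] := IH L; first by move: hk => /=; rewrite ltnS.
  by move=> P' h; apply: hL; right.
have [hPy|hPy] := EM (P y); last by exists y; split=> // P' [<-|/h3].
have [hP hIP hMP] := hL P (or_introl erefl).
have hPi := prime_ideal hP.
have [|w [hw1 hw2 hw3]] := @avoid_product P I (M :: L) hP hI hIP.
  move=> P' [<-//|h]; split; first by have [/prime_ideal] := hL P' (or_intror h).
  by move=> h'; apply: hnot; exists P'.
exists (y + w); split; [exact: idealD|by apply: hNM => //; apply: hw3; left|].
move=> P' [<- h|h h'].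
  by apply: hw2; rewrite -(addKr y w) addrC; apply: idealB.
apply: (h3 P' h); have [/prime_ideal hP'i _ _] := hL P' (or_intror h).
by rewrite -(addrK w y); apply: idealB => //; apply: hw3; right.
Qed.

Definition adjs A (l : seq R) := foldr (fun y B => adj B y) A l.
Lemma adjs_ideal A l : is_ideal A -> is_ideal (adjs A l).
Proof. by move=> hA; elim: l => //= y l; apply: adj_ideal. Qed.
Lemma adjs_annihilated A l q v : is_ideal A -> (forall y, In y l -> A (q * y)) ->
  adjs A l v -> A (q * v).
Proof.
move=> hA; elim: l v => [|y l IH] v hl /=; first by move=> h; apply: idealMl.
move=> /adjP [r hr]; rewrite -(subrK (r * y) v) mulrDr; apply: idealD => //.
  by apply: IH => // u hu; apply: hl; right.
by rewrite mulrCA; apply: idealMl => //; apply: hl; left.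
Qed.

(** Zero divisors on [R/A] lie in associated primes, and an ideal covered by finitely many of them
    lies in one. Finiteness is supplied by a finite list [l] that generates, over [A], every element
    with a maximal annihilator. *)
Lemma common_annihilator A I : noetherian R -> is_ideal A -> is_ideal I ->
  (forall y, I y -> exists2 w, ~ A w & A (y * w)) ->
  exists2 w, ~ A w & forall y, I y -> A (y * w).
Proof.
move=> hN hA hI hz.
pose G y := [/\ ~ A y, is_prime (colon A y) &
  forall v, ~ A v -> incl (colon A y) (colon A v) -> incl (colon A v) (colon A y)].
have [||_ [[l hl ->] hmax]] := @noetherian_max R
    (fun B => exists2 l, (forall y, In y l -> G y) & B = adjs A l) hN.
- by exists A, nil.
- by move=> _ [l _ ->]; apply: adjs_ideal.
have hG v : G v -> adjs A l v.
  move=> hv; apply: (hmax (adjs A (v :: l))).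
  - by exists (v :: l) => // y [<-|/hl].
  - exact: adj_l.
  - by apply: adj_r; apply: adjs_ideal.
apply: contrapT => hno.
have [||||y [hIy _ hy]] := @prime_avoidance I (fun=> True) (fun=> False)
    (List.map (colon A) l) hI.
- by split.
- by move=> ? ? ? _ [].
- by exists 0 => //; apply: ideal0.
- move=> _ /in_map_iff [v [<- hv]]; have [h1 h2 h3] := hl v hv; split=> //.
    by move=> h; apply: hno; exists v.
  by move=> h; apply: h1; have := h 1 Logic.I; rewrite /colon mul1r.
(* The maximal annihilator [colon A v] above that of [w] contains [y], hence contains no [colon A u]
   with [u] in [l]. So some [q] outside it kills all of [l], although [v] is generated by [l] over
   [A]. *)
have [w hw hyw] := hz y hIy.
have [v [hv1 hv2 hv3 hv4]] := max_annihilator hN hA hw.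
have [[u hu huv]|hnot] := EM (exists2 u, In u l & incl (colon A u) (colon A v)).
  apply: (hy (colon A u)); first by apply/in_map_iff; exists u.
  by have [_ _ hm] := hl u hu; apply: (hm v) => //; apply: hv2.
have [|||q [_ hq1 hq2]] := @avoid_product (colon A v) (fun=> True) (List.map (colon A) l) hv3.
- by split.
- by move=> h; apply: hv1; have := h 1 Logic.I; rewrite /colon mul1r.
- move=> _ /in_map_iff [u [<- hu]]; split; first exact: colon_ideal.
  by move=> h; apply: hnot; exists u.
apply: hq1; apply: (@adjs_annihilated _ l) => //; last by apply: hG; split.
by move=> u hu; apply: (hq2 (colon A u)); apply/in_map_iff; exists u.
Qed.

Lemma local_prime m : local_max m -> @is_prime R m.
Proof.
move=> [hm hu]; split=> //; split; first by move=> /hu; rewrite unitr1.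
move=> x y /hu; rewrite unitrM negb_and => /orP [h|h]; [left|right]; exact/hu.
Qed.

Lemma local_unit m x : local_max m -> ~ m x -> x \is a @GRing.unit R.
Proof. by move=> [_ hu] hx; apply: contrapT => /negP h; apply/hx/hu. Qed.

Lemma prime_sub_local m P : local_max m -> is_prime P -> incl P m.
Proof.
move=> hm hP x hx; apply: contrapT => /(local_unit hm) hu; apply: (prime1 hP).
by rewrite -(mulVr hu); apply: idealMl => //; apply: prime_ideal.
Qed.

Lemma ideal_unit A s x : is_ideal A -> s \is a @GRing.unit R -> A (s * x) -> A x.
Proof. by move=> hA hs h; rewrite -(mulKr hs x); apply: idealMl. Qed.

(** * Regular local rings: Koszul exactness in degree one *)

Definition alternating d (B : 'I_d -> 'I_d -> R) :=
  (forall i, B i i = 0) /\ (forall i j, B i j = - B j i).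

Lemma alternating_sum d (B : 'I_d -> 'I_d -> R) (x : 'I_d -> R) : alternating B ->
  \sum_i (\sum_j B i j * x j) * x i = 0.
Proof.
move=> [h0 hN]; under eq_bigr do rewrite big_distrl.
apply: (@big_alternating R R^o) => [i|i j]; first by rewrite /= h0 !mul0r.
by rewrite /= (hN i j); ring.
Qed.

(* The first Koszul homology of y on R/A vanishes. *)
Definition koszul_exact A d (y : 'I_d -> R) :=
  forall c : 'I_d -> R, A (\sum_i c i * y i) ->
  exists2 B, alternating B & forall i, A (c i - \sum_j B i j * y j).

Definition ocons T d (u : T) (v : 'I_d -> T) (i : 'I_d.+1) : T :=
  if unlift ord0 i is Some j then v j else u.
Lemma ocons0 T d (u : T) (v : 'I_d -> T) : ocons u v ord0 = u.
Proof. by rewrite /ocons unlift_none. Qed.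
Lemma oconsS T d (u : T) (v : 'I_d -> T) i : ocons u v (lift ord0 i) = v i.
Proof. by rewrite /ocons liftK. Qed.

(** The long exact sequence of multiplication by [y0], in coordinates. Exactness modulo [y0] gives
    [B] up to an error [h * y0]; [h] fills the new row and column, and the equation at index 0
    follows by cancelling [y0] modulo the prime [A]. *)
Lemma koszul_exact_cons A d y0 (y : 'I_d -> R) : is_prime A -> ~ A y0 ->
  koszul_exact (adj A y0) y -> koszul_exact A (ocons y0 y).
Proof.
move=> hA hy0 hK c; have hAi := prime_ideal hA.
rewrite big_ord_recl ocons0; under eq_bigr do rewrite oconsS.
set c' := fun i => c (lift ord0 i); set c0 := c ord0 => hc.
have [|B hB hBc] := hK c'.
  apply/adjP; exists (- c0).
  by rewrite mulNr opprK addrC.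
have /choice [h hh] : forall i, exists h, A (c' i - \sum_j B i j * y j - h * y0).
  by move=> i; have /adjP [h] := hBc i; exists h.
exists (ocons (ocons 0 (fun i => - h i)) (fun i => ocons (h i) (B i))).
  split=> [i|i j].
    by case: (unliftP ord0 i) => [k|] ->; rewrite ?ocons0 // !oconsS hB.1.
  case: (unliftP ord0 i) => [k|] ->; case: (unliftP ord0 j) => [l|] ->;
    rewrite ?(ocons0, oconsS) ?opprK ?oppr0 //; exact: hB.2.
move=> i; rewrite big_ord_recl ocons0; under eq_bigr do rewrite oconsS.
case: (unliftP ord0 i) => [k|] ->; last first.
  rewrite !ocons0 mul0r add0r; under eq_bigr do rewrite oconsS mulNr.
  rewrite sumrN opprK; apply: (@primeMl _ _ y0) => //.
  have hs : A (\sum_i (c' i - \sum_j B i j * y j - h i * y0) * y i).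
    by apply: ideal_sum => // j _; apply: idealMr.
  have := idealB hAi hc hs; congr A.
  under [X in _ - X]eq_bigr do rewrite !mulrBl.
  rewrite !sumrB (alternating_sum _ hB) mulrDr big_distrr /= /c0 /c'.
  under [X in _ - (_ - X)]eq_bigr do rewrite mulrAC mulrC.
  ring.
rewrite !oconsS ocons0; under eq_bigr do rewrite oconsS.
by have := hh k; congr A; rewrite /c'; ring.
Qed.

(** Stated relative to [A] so that the induction can replace [A] by [A + (y)] inside the same ring.
    The chain bounds the dimension of [R/A] below by the number of generators. Primality of [A] is
    part of the conclusion because it makes [y] a nonzerodivisor one level up. *)
Lemma regular_local_koszul_rel m d A (x : 'I_d -> R) (P : nat -> R -> Prop) :
  noetherian R -> local_max m -> is_ideal A ->
  (forall w, m w <-> iadd A (span x) w) ->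
  prime_chain d P -> incl A (P 0%N) ->
  is_prime A /\ exists2 y : 'I_d -> R,
    (forall w, m w <-> iadd A (span y) w) & koszul_exact A y.
Proof.
move=> hN hm; have hmP := local_prime hm; have hmi := prime_ideal hmP.
elim: d A x P => [|d IH] A x P hA hx hP hAP.
  split; last first.
    by exists x => // c _; exists (fun=> fun=> 0); [split=> // i j; rewrite oppr0|case].
  suff <- : m = A by [].
  apply: funext => w; apply: propext; rewrite hx; split=> [|hw]; last exact: (iaddl (span_ideal x)).
  by move=> [a [_ [ha [c ->] ->]]]; rewrite big_ord0 addr0.
have hAm : incl A m by move=> w hw; apply/hx/iaddl => //; apply: span_ideal.
have hxm i : m (x i) by apply/hx/iaddr => //; apply: span_mem.
(* [N] is [A + m^2], expressed through the generators [x]. *)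
pose N w := exists c : 'I_d.+1 -> R, (forall i, m (c i)) /\ A (w - \sum_i c i * x i).
have hNi : is_ideal N.
  split; [|split].
  - exists (fun=> 0); split=> [i|]; first exact: ideal0.
    by rewrite big1 ?subr0 => [|i _]; rewrite ?mul0r //; apply: ideal0.
  - move=> u v [c [hc hu]] [c' [hc' hv]]; exists (fun i => c i + c' i).
    split=> [i|]; first exact: idealD.
    under eq_bigr do rewrite mulrDl.
    by rewrite big_split opprD addrACA; apply: idealD.
  - move=> r u [c [hc hu]]; exists (fun i => r * c i); split=> [i|]; first exact: idealMl.
    by under eq_bigr do rewrite -mulrA; rewrite -big_distrr -mulrBr; apply: idealMl.
have [hP1 hP2] := hP.
have hmP0 : ~ incl m (P 0%N).
  have [_ [w [hw hw']]] := hP2 0%N isT.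
  by move=> h; apply: hw'; apply: h; apply: (prime_sub_local hm (hP1 1%N isT)).
have hmN : exists2 y, m y & ~ N y.
  apply: contrapT => hn; apply: hmP0.
  have [i|s hs hsx] := @nakayama_prime R m A d.+1 x hmP hA.
    have [c [hc hA']] : N (x i) by apply: contrapT => h; apply: hn; exists (x i).
    by exists 1, c; rewrite mul1r; split=> //; apply: prime1.
  have hxA i : A (x i) by apply: ideal_unit (hsx i) => //; apply: local_unit hs.
  by move=> w /hx; move/(iadd_incl hA (fun u hu => hu) (span_incl hA hxA))/hAP.
have [L [hL1 hL2]] := finite_minimal_primes hN hA.
pose L' := List.filter (fun P => `[< ~ incl m P >]) L.
have hL' P' : In P' L' <-> In P' L /\ ~ incl m P'.
  by rewrite /L' filter_In; split=> -[h1] /asboolP h2.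
(* [y] is part of a minimal generating set modulo [A] and avoids every prime of [L] other than
   [m]. *)
have [||y [hym hyN hyL]] := @prime_avoidance m N N L' hmi hNi _ hmN.
- by move=> u v hu hv h; apply: hu; rewrite -(addrK v u); apply: idealB.
- move=> P' /hL' [/hL1 [hP' hAP'] hmP']; split=> // h; apply: hmP' => w hw.
  apply: (@primeX _ _ _ 2) => //; apply: h.
  have /hx [a [_ [ha [c ->] ew]]] := hw.
  exists (fun i => w * c i); split=> [i|]; first exact: idealMr.
  under eq_bigr do rewrite -mulrA.
  rewrite -big_distrr /= expr2 -mulrBr {2}ew addrK; exact: idealMl.
have /hx [a [_ [ha [c ->] ey]]] := hym.
have [i0 hi0] : exists i0, ~ m (c i0).
  apply: contrapT => hn; apply: hyN; exists c; split; last by rewrite ey addrK.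
  by move=> i; apply: contrapT => h; apply: hn; exists i.
pose x' (j : 'I_d) := x (lift i0 j).
pose T := iadd (adj A y) (span x').
have hAy : is_ideal (adj A y) by apply: adj_ideal.
have hT : is_ideal T by apply: iadd_ideal => //; apply: span_ideal.
have hAT : incl A T by move=> w hw; apply: iaddl; [exact: span_ideal|exact: adj_l].
have hyT : T y by apply: iaddl; [exact: span_ideal|exact: adj_r].
have hx'T j : T (x' j) by apply: iaddr => //; apply: span_mem.
have hx' w : m w <-> iadd (adj A y) (span x') w.
  split; last first.
    apply: iadd_incl => //; first exact: adj_incl.
    by apply: span_incl => // j; apply: hxm.
  move=> /hx; apply: (iadd_incl hT hAT); apply: span_incl => // i.
  case: (unliftP i0 i) => [j|] ->; first exact: hx'T.
  apply: (ideal_unit hT (local_unit hm hi0)).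
  move: ey; rewrite (bigD1 i0) //= => ey.
  rewrite (_ : c i0 * x i0 = y - a - \sum_(i < d.+1 | i != i0) c i * x i); last first.
    by rewrite ey; ring.
  apply: idealB => //; first by apply: idealB => //; apply: hAT.
  apply: ideal_sum => // j; case: (unliftP i0 j) => [k|] ->; last by rewrite eqxx.
  by move=> _; apply: idealMl => //; apply: hx'T.
(* The top prime is replaced by [m], which is certain to contain [y]. *)
have [||P' [hP'1 hP'2 hP'3 hP'4]] := @chain_slide y d
    (fun i => if (i <= d)%N then P i else m) hN.
- split=> i hi /=; first by case: leqP => // hi'; apply: hP1.
  move: hi; rewrite ltnS; case: (ltngtP i d) => // [hi _|-> _].
    by apply: hP2; apply: leqW.
  have [h [w [hw hw']]] := hP2 d (ltnSn d).
  have hPm := prime_sub_local hm (hP1 d.+1 (leqnn _)).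
  by split=> [u /h /hPm //|]; exists w; split=> //; apply: hPm.
- by rewrite ltnn.
have hAyP' : incl (adj A y) (P' 0%N).
  apply: adj_incl => //; first by apply: prime_ideal; apply: hP'1.1.
  by move=> w /hAP; apply: hP'3.
have [hAyp [y' hy' hK]] := IH (adj A y) x' P' hAy hx' hP'1 hAyP'.
have [P0 hP0 hP0A] : exists2 P0, In P0 L' & incl P0 (adj A y).
  have [hmA|hmA] := EM (incl m (adj A y)).
    have [P0 h1 h2] := hL2 (P 0%N) (hP1 0%N isT) hAP.
    exists P0; first by apply/hL'; split=> // h; apply: hmP0 => w /h /h2.
    by move=> w hw; apply/hmA/(prime_sub_local hm (hL1 _ h1).1).
  have [|P0 h1 h2] := hL2 (adj A y) hAyp; first exact: adj_l.
  by exists P0 => //; apply/hL'; split=> // h; apply: hmA => w /h /h2.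
have hP0y := hyL P0 hP0.
have /hL' [/hL1 [hP0p hAP0] _] := hP0.
(* [P0] lies in [A + (y)] and omits [y], so it equals [A + y P0], and Nakayama gives [A]. *)
have eA : A = P0.
  apply: funext => w; apply: propext; split; first exact: hAP0.
  have [k [g hg]] := hN P0 (prime_ideal hP0p).
  have [i|s hs hsg] := @nakayama_prime R m A k g hmP hA.
    have hgi := generated_mem i hg.
    have /adjP [q hq] := hP0A _ hgi.
    have /hg [b hb] : P0 q.
      apply: (@primeMl _ _ y) => //; rewrite mulrC -(subKr (g i) (q * y)).
      by apply: idealB => //; [exact: prime_ideal|exact: hAP0].
    exists 1, (fun j => b j * y); split; first exact: prime1.
      by move=> j; apply: idealMl.
    rewrite mul1r; move: hq; rewrite hb big_distrl /=.
    by under eq_bigr do rewrite mulrAC.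
  move=> /hg; apply: span_incl => // i.
  by apply: ideal_unit (hsg i) => //; apply: local_unit hs.
have hAp : is_prime A by rewrite eA.
split=> //; exists (ocons y y'); last by apply: koszul_exact_cons => //; rewrite eA.
move=> w; rewrite hy'; split.
  apply: iadd_incl; first by apply: iadd_ideal => //; apply: span_ideal.
    apply: adj_incl; first by apply: iadd_ideal => //; apply: span_ideal.
      exact/iaddl/span_ideal.
    by apply: iaddr => //; have := span_mem (ocons y y') ord0; rewrite ocons0.
  apply: span_incl; first by apply: iadd_ideal => //; apply: span_ideal.
  by move=> i; apply: iaddr => //; have := span_mem (ocons y y') (lift ord0 i); rewrite oconsS.
have hT' : is_ideal (iadd (adj A y) (span y')) by apply: iadd_ideal => //; apply: span_ideal.
apply: iadd_incl => //; first by move=> u hu; apply: iaddl; [exact: span_ideal|exact: adj_l].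
apply: span_incl => // i; case: (unliftP ord0 i) => [j|] ->; rewrite ?oconsS ?ocons0.
  by apply: iaddr => //; apply: span_mem.
by apply: iaddl; [exact: span_ideal|exact: adj_r].
Qed.

Lemma regular_local_koszul m : @regular_local R m ->
  exists d (y : 'I_d -> R), generated_by m y /\ koszul_exact (fun x => x = 0) y.
Proof.
move=> [hN [hm [d [[[P hP] _] [[x hx] _]]]]].
have h0 : is_ideal (fun x : R => x = 0).
  by split=> //; split=> [_ _ -> ->|r _ ->]; rewrite ?addr0 ?mulr0.
have e0 n (g : 'I_n -> R) w : iadd (fun x => x = 0) (span g) w <-> span g w.
  split; last exact: iaddr.
  by move=> [_ [b [-> hb ->]]]; rewrite add0r.
have [||_ [y hy hK]] := @regular_local_koszul_rel m d _ x P hN hm h0 _ hP.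
- by move=> w; rewrite e0; apply: hx.
- by move=> _ ->; apply: ideal0; apply: prime_ideal; apply: hP.1.
by exists d, y; split=> // w; rewrite hy e0.
Qed.

End Primes.

(** * Koszul complexes *)

Section KoszulOps.
Variables (R : comUnitRingType) (n : nat).

(** Finite functions carry a module structure, which turns the operators below into linear maps;
    [tokff] translates from [kelt]. *)
Definition kff := {ffun {set 'I_n} -> R^o}.
HB.instance Definition _ := GRing.Lmodule.on kff.
Implicit Types (x y : kff) (p q : 'I_n) (U : {set 'I_n}).

(* Without the explicit ring, unification would pick the regular algebra R^o. *)
Local Notation kdg := (@kdeg R n).

Definition tokff (x : kelt R n) : kff := [ffun U : {set 'I_n} => x U : R^o].

Definition sgn p U : R := (-1) ^+ #|[set u in U | (u < p)%N]|.

Lemma sgn_add p q U : q \notin U -> sgn p (q |: U) = (-1) ^+ (q < p)%N * sgn p U.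
Proof.
move=> hq; rewrite /sgn -exprD; congr (_ ^+ _).
have [hqp|hqp] := boolP (q < p)%N; last first.
  rewrite add0n; apply: eq_card => u; rewrite !inE.
  by case: eqP => //= ->; rewrite (negPf hqp) andbF.
rewrite (_ : [set _ in _ | _] = q |: [set u in U | (u < p)%N]).
  by rewrite cardsU1 !inE (negPf hq).
by apply/setP => u; rewrite !inE; case: eqP => //= ->; rewrite hqp.
Qed.

Lemma sgn_self p U : sgn p (U :\ p) = sgn p U.
Proof.
rewrite /sgn; congr (_ ^+ _); apply: eq_card => u; rewrite !inE.
by case: eqP => //= ->; rewrite ltnn andbF.
Qed.

Lemma sgn_sq p U : sgn p U * sgn p U = 1.
Proof. by rewrite -expr2 sqrr_sign. Qed.

Lemma sgn_swap p q U : p != q -> p \notin U -> q \notin U ->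
  sgn p U * sgn q (p |: U) = - (sgn q U * sgn p (q |: U)).
Proof.
move=> hpq hp hq; rewrite !sgn_add //.
have : val p != val q by rewrite (inj_eq val_inj).
by case: (ltngtP p q) => //= h _; rewrite expr0 expr1; ring.
Qed.

(** Left exterior multiplication by the basis vector [p]; [iot] is the dual contraction. The sign
    counts the members of [U] before [p]. *)
Definition eps p x : kff := [ffun U : {set 'I_n} => if p \in U then sgn p U * x (U :\ p) else 0].
Definition iot p x : kff := [ffun U : {set 'I_n} => if p \in U then 0 else sgn p U * x (p |: U)].

Lemma eps_is_linear p : linear (eps p).
Proof.
move=> a x y; apply/ffunP => U; rewrite !ffunE; case: ifP => _; last by rewrite scaler0 addr0.
by rewrite mulrDr; congr (_ + _); rewrite /GRing.scale /= mulrCA.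
Qed.
HB.instance Definition _ p := GRing.isLinear.Build R kff kff _ (eps p) (eps_is_linear p).
Lemma iot_is_linear p : linear (iot p).
Proof.
move=> a x y; apply/ffunP => U; rewrite !ffunE; case: ifP => _; first by rewrite scaler0 addr0.
by rewrite mulrDr; congr (_ + _); rewrite /GRing.scale /= mulrCA.
Qed.
HB.instance Definition _ p := GRing.isLinear.Build R kff kff _ (iot p) (iot_is_linear p).

Lemma iotK p x : iot p (iot p x) = 0.
Proof. by apply/ffunP => U; rewrite !ffunE; case: ifP => //; rewrite setU11 mulr0. Qed.

Lemma iotC p q x : iot p (iot q x) = - iot q (iot p x).
Proof.
have [->|hpq] := eqVneq p q; first by rewrite iotK oppr0.
apply/ffunP => U; rewrite !ffunE !inE.
have [hp|hp] := boolP (p \in U); have [hq|hq] := boolP (q \in U);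
  rewrite ?orbT ?mulr0 ?oppr0 //.
rewrite !orbF eq_sym (negPf hpq) !mulrA (sgn_swap hpq) // mulNr.
by rewrite setUCA.
Qed.

Lemma epsK p x : eps p (eps p x) = 0.
Proof. by apply/ffunP => U; rewrite !ffunE; case: ifP => //; rewrite setD11 mulr0. Qed.

Lemma epsC p q x : eps p (eps q x) = - eps q (eps p x).
Proof.
have [->|hpq] := eqVneq p q; first by rewrite epsK oppr0.
apply/ffunP => U; rewrite !ffunE !inE hpq eq_sym hpq /=.
have [hp|hp] := boolP (p \in U); have [hq|hq] := boolP (q \in U);
  rewrite ?mulr0 ?oppr0 //.
pose W := U :\ p :\ q.
have hW : W = U :\ q :\ p by rewrite /W !setDDl setUC.
have hpW : p \notin W by rewrite !inE eqxx andbF.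
have hqW : q \notin W by rewrite !inE eqxx.
have eq_p : U :\ q = p |: W by rewrite hW setD1K // !inE hpq.
have eq_q : U :\ p = q |: W by rewrite setD1K // !inE eq_sym hpq.
rewrite -/W -hW !mulrA -mulNr; congr (_ * _).
rewrite -(sgn_self p U) -(sgn_self q U) eq_p eq_q !sgn_add // !ltnn !expr0 !mul1r.
have : val p != val q by rewrite (inj_eq val_inj).
by case: (ltngtP p q) => //= h _; rewrite expr0 expr1; ring.
Qed.

Lemma iot_eps p q x : iot p (eps q x) + eps q (iot p x) = (p == q)%:R *: x.
Proof.
apply/ffunP => U; rewrite !ffunE !inE /GRing.scale /=.
have [->|hpq] := eqVneq p q.
  rewrite mul1r /= ; case: ifP => h; rewrite ?add0r ?addr0 /=.
    by rewrite sgn_self mulrA sgn_sq mul1r setD1K.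
  rewrite sgn_add ?h // ltnn expr0 mul1r mulrA sgn_sq mul1r setU1K //; exact: negbT.
rewrite mul0r /=.
have [hp|hp] := boolP (p \in U); have [hq|hq] := boolP (q \in U);
  rewrite ?mulr0 ?addr0 //=.
set W := U :\ q.
have hqW : q \notin W by rewrite !inE eqxx.
have hpW : p \notin W by rewrite !inE (negPf hp) andbF.
have -> : U = q |: W by rewrite setD1K.
have hqpW : q \notin p |: W by rewrite !inE negb_or eq_sym hpq eqxx.
rewrite setUCA setU1K //.
rewrite !mulrA -mulrDl.
rewrite (sgn_add q hqpW) ltnn expr0 mul1r (sgn_add q hqW) ltnn expr0 mul1r.
rewrite !sgn_add //.
have : val p != val q by rewrite (inj_eq val_inj).
by case: (ltngtP p q) => //= h _; rewrite expr0 expr1; ring.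
Qed.

Definition dif (f : 'I_n -> R) x : kff := \sum_p f p *: iot p x.
Definition op (h : 'I_n -> R) x : kff := \sum_p h p *: eps p x.

Lemma dif_is_linear f : linear (dif f).
Proof.
move=> a x y; rewrite /dif scaler_sumr -big_split; apply: eq_bigr => p _ /=.
by rewrite linearP scalerDr !scalerA mulrC.
Qed.
HB.instance Definition _ f := GRing.isLinear.Build R kff kff _ (dif f) (dif_is_linear f).
Lemma op_is_linear f : linear (op f).
Proof.
move=> a x y; rewrite /op scaler_sumr -big_split; apply: eq_bigr => p _ /=.
by rewrite linearP scalerDr !scalerA mulrC.
Qed.
HB.instance Definition _ f := GRing.isLinear.Build R kff kff _ (op f) (op_is_linear f).

Lemma dif_dif f x : dif f (dif f x) = 0.
Proof.
rewrite {1}/dif (eq_bigr (fun p => \sum_q (f p * f q) *: iot p (iot q x))).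
  apply: big_alternating => [p|p q]; first by rewrite iotK scaler0.
  by rewrite iotC scalerN mulrC.
move=> p _; rewrite /dif linear_sum scaler_sumr; apply: eq_bigr => q _.
by rewrite linearZ scalerA.
Qed.

Lemma op_op h k x : op h (op k x) = - op k (op h x).
Proof.
rewrite /op -sumrN.
under eq_bigr do rewrite linear_sum scaler_sumr.
under [RHS]eq_bigr do rewrite linear_sum scaler_sumr -sumrN.
rewrite exchange_big /=; apply: eq_bigr => p _; apply: eq_bigr => q _.
by rewrite !linearZ /= !scalerA epsC scalerN mulrC.
Qed.

Lemma opK h x : op h (op h x) = 0.
Proof.
rewrite {1}/op (eq_bigr (fun p => \sum_q (h p * h q) *: eps p (eps q x))).
  apply: big_alternating => [p|p q]; first by rewrite epsK scaler0.
  by rewrite epsC scalerN mulrC.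
move=> p _; rewrite /op linear_sum scaler_sumr; apply: eq_bigr => q _.
by rewrite linearZ scalerA.
Qed.

Lemma dif_eps f p x : dif f (eps p x) + eps p (dif f x) = f p *: x.
Proof.
rewrite /dif linear_sum -big_split /= (bigD1 p) //= big1 ?addr0 => [|q /negPf hq].
  by rewrite linearZ -scalerDr iot_eps eqxx scale1r.
by rewrite linearZ -scalerDr iot_eps hq scale0r scaler0.
Qed.

(** The derivation rule, which yields two homotopies: the value of [h] at [f] acts as zero on
    homology, and if that value is 0, multiplication by [h] anticommutes with the differential. *)
Lemma dif_op f h x : dif f (op h x) + op h (dif f x) = (\sum_p h p * f p) *: x.
Proof.
rewrite /op linear_sum -big_split scaler_suml; apply: eq_bigr => p _ /=.
by rewrite linearZ /= -scalerDr dif_eps scalerA.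
Qed.

Lemma kdiffE f (x : kelt R n) U : kdiff f x U = dif f (tokff x) U.
Proof.
rewrite /kdiff /dif sum_ffunE big_mkcond; apply: eq_bigr => p _.
rewrite !ffunE /GRing.scale /=; case: (p \in U); first by rewrite mulr0.
by rewrite /sgn mulrA [f p * _]mulrC.
Qed.

Lemma kdiff_kff f x U : @kdiff R n f x U = dif f x U.
Proof.
rewrite kdiffE; congr (dif f _ U).
by apply/ffunP => W; rewrite ffunE.
Qed.

Lemma iot_deg p i x : kdg i.+1 x -> kdg i (iot p x).
Proof.
move=> hx U hU; rewrite ffunE; case: ifP => // h.
by rewrite hx ?mulr0 // cardsU1 h add1n eqSS.
Qed.
Lemma eps_deg p i x : kdg i x -> kdg i.+1 (eps p x).
Proof.
move=> hx U hU; rewrite ffunE; case: ifP => // h.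
rewrite hx ?mulr0 //; move: hU.
by rewrite (cardsD1 p U) h add1n eqSS.
Qed.
Lemma kdegP i a x y : kdg i x -> kdg i y -> kdg i (a *: x + y).
Proof. by move=> hx hy U hU; rewrite !ffunE hx // hy // scaler0 addr0. Qed.
Lemma kdeg0 i : kdg i (0 : kff). Proof. by move=> U _; rewrite ffunE. Qed.
Lemma kdegD i x y : kdg i x -> kdg i y -> kdg i (x + y).
Proof. by move=> hx hy; rewrite -(scale1r x); apply: kdegP. Qed.
Lemma kdegZ i a x : kdg i x -> kdg i (a *: x).
Proof. by move=> hx; rewrite -(addr0 (a *: x)); apply: kdegP => //; apply: kdeg0. Qed.
Lemma kdegN i x : kdg i x -> kdg i (- x).
Proof. by move=> hx; rewrite -scaleN1r; apply: kdegZ. Qed.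
Lemma kdegB i x y : kdg i x -> kdg i y -> kdg i (x - y).
Proof. by move=> hx hy; apply: kdegD => //; apply: kdegN. Qed.
Lemma kdeg_sum i (T : Type) (s : seq T) (P : pred T) (F : T -> kff) :
  (forall t, P t -> kdg i (F t)) -> kdg i (\sum_(t <- s | P t) F t).
Proof.
move=> hF; apply: (big_ind (fun x : kff => kdg i x)) => //; first exact: kdeg0.
by move=> x y; apply: kdegD.
Qed.
Lemma dif_deg f i x : kdg i.+1 x -> kdg i (dif f x).
Proof. by move=> hx; apply: kdeg_sum => p _; apply: kdegZ; apply: iot_deg. Qed.
Lemma op_deg h i x : kdg i x -> kdg i.+1 (op h x).
Proof. by move=> hx; apply: kdeg_sum => p _; apply: kdegZ; apply: eps_deg. Qed.
Lemma kdeg_big i x : (n < i)%N -> kdg i x -> x = 0.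
Proof.
move=> hi hx; apply/ffunP => U; rewrite ffunE hx //; apply/eqP => hU.
by move: (max_card U); rewrite card_ord hU leqNgt hi.
Qed.

Lemma dif_set0 f x : (dif f x set0 : R) = \sum_p f p * (x [set p] : R).
Proof.
rewrite /dif sum_ffunE; apply: eq_bigr => p _; rewrite !ffunE inE setU0.
rewrite /sgn (_ : [set u in set0 | _] = set0) ?cards0 ?expr0 ?mul1r //.
by apply/setP => u; rewrite !inE.
Qed.

(** * Depth sensitivity *)

Variable f : 'I_n -> R.
Implicit Types (A : R -> Prop).

Definition coefs A x := forall U, A (x U).
Lemma coefsP A a x y : is_ideal A -> coefs A x -> coefs A y -> coefs A (a *: x + y).
Proof.
move=> hA hx hy U; rewrite !ffunE; apply: idealD => //.
by rewrite /GRing.scale /=; apply: idealMl.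
Qed.
Lemma coefs0 A : is_ideal A -> coefs A 0.
Proof. by move=> hA U; rewrite ffunE; apply: ideal0. Qed.
Lemma coefsD A x y : is_ideal A -> coefs A x -> coefs A y -> coefs A (x + y).
Proof. by move=> hA hx hy; rewrite -(scale1r x); apply: coefsP. Qed.
Lemma coefsZ A a x : is_ideal A -> coefs A x -> coefs A (a *: x).
Proof. by move=> hA hx; rewrite -(addr0 (a *: x)); apply: coefsP => //; apply: coefs0. Qed.
Lemma coefsB A x y : is_ideal A -> coefs A x -> coefs A y -> coefs A (x - y).
Proof. by move=> hA hx hy; rewrite -scaleN1r addrC; apply: coefsP. Qed.
Lemma coefs_sum A (T : Type) (s : seq T) (P : pred T) (F : T -> kff) : is_ideal A ->
  (forall t, P t -> coefs A (F t)) -> coefs A (\sum_(t <- s | P t) F t).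
Proof.
move=> hA hF; apply: (big_ind (coefs A)) => //; first exact: coefs0.
by move=> x y; apply: coefsD.
Qed.
Lemma coefs_dif A g x : is_ideal A -> coefs A x -> coefs A (dif g x).
Proof.
move=> hA hx; apply: coefs_sum => // p _; apply: coefsZ => // U.
by rewrite ffunE; case: ifP => _; [exact: ideal0|exact: idealMl].
Qed.
Lemma coefs_op A g x : is_ideal A -> coefs A x -> coefs A (op g x).
Proof.
move=> hA hx; apply: coefs_sum => // p _; apply: coefsZ => // U.
by rewrite ffunE; case: ifP => _; [exact: idealMl|exact: ideal0].
Qed.

(* H_i(f; R/A) = 0. *)
Definition hvan A i := forall c : kff, kdg i c -> coefs A (dif f c) ->
  exists2 y : kff, kdg i.+1 y & coefs A (c - dif f y).

Lemma coefs_adj A a i y : is_ideal A -> kdg i y -> coefs (adj A a) y ->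
  exists2 q : kff, kdg i q & coefs A (y - a *: q).
Proof.
move=> hA hy hc.
have /choice [q hq] : forall U, exists r, A (y U - r * a) by move=> U; apply/adjP/hc.
exists [ffun U : {set 'I_n} => (if #|U| == i then q U else 0 : R^o)].
  by move=> U /negPf h; rewrite ffunE h.
move=> U; rewrite !ffunE /GRing.scale /=; case: ifP => h; first by rewrite mulrC.
by rewrite hy ?h // mulr0 subr0; apply: ideal0.
Qed.

(** [op h] is a homotopy showing that [a] kills the homology over [R/A]. Hence the connecting map
    onto H_i is surjective, and its source is assumed to vanish. *)
Lemma hvan_quotient A a i : is_ideal A -> span f a ->
  (forall b, A (a * b) -> A b) -> hvan (adj A a) i.+1 -> hvan A i.
Proof.
move=> hA [h ha] hreg hvn c hc hdc.
have hAa : is_ideal (adj A a) by apply: adj_ideal.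
have e := dif_op f h c; rewrite -ha in e.
have hsub x : coefs A x -> coefs (adj A a) x by move=> hx U; apply: adj_l.
have hmul x : coefs (adj A a) (a *: x).
  by move=> U; rewrite ffunE /GRing.scale /=; apply: idealMr => //; apply: adj_r.
have [||w hw1 hw2] := hvn (op h c); first exact: op_deg.
  rewrite -(addrK (op h (dif f c)) (dif f _)) e.
  by apply: coefsB => //; apply: hsub; apply: coefs_op.
have [|q hq1 hq2] := @coefs_adj A a i.+1 _ hA _ hw2.
  by apply: kdegB; [exact: op_deg|exact: dif_deg].
exists q => // U; apply: hreg.
have h1 := coefs_dif f hA hq2.
rewrite !linearB /= dif_dif subr0 linearZ /= in h1.
have := coefsD hA h1 (coefs_op h hA hdc).
rewrite addrAC e -scalerBr => /(_ U).
by rewrite ffunE /GRing.scale /=.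
Qed.

(** The piece of the long exact sequence of multiplication by [a] in which the homology over the
    quotient by [a] sits between the two that vanish. *)
Lemma hvan_quotientN A a i : is_ideal A -> (forall b, A (a * b) -> A b) ->
  hvan A i.+1 -> hvan A i -> hvan (adj A a) i.+1.
Proof.
move=> hA hreg hv1 hv0 c hc hdc.
have [b hb1 hb2] := coefs_adj hA (dif_deg f hc) hdc.
have [|q hq1 hq2] := hv0 b hb1.
  move=> U; apply: hreg.
  have h1 := coefs_dif f hA hb2.
  rewrite linearB /= dif_dif sub0r linearZ /= in h1.
  have := idealN hA (h1 U).
  by rewrite !ffunE opprK /GRing.scale /=.
have [||w hw1 hw2] := hv1 (c - a *: q).
- by apply: kdegB => //; apply: kdegZ.
- rewrite linearB linearZ /=.
  have := coefsD hA hb2 (coefsZ a hA hq2).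
  by rewrite scalerBr addrA subrK.
exists w => // U; have hh := hw2 U.
apply/adjP; exists (q U); move: hh; congr A.
by rewrite !ffunE /GRing.scale /=; ring.
Qed.

Lemma hvan_eq A B i : (forall a, A a <-> B a) -> hvan A i -> hvan B i.
Proof.
by move=> e; suff -> : A = B by []; apply: funext => a; apply: propext.
Qed.

End KoszulOps.

(** * Grade and the top degree of Koszul homology *)

Section Grade.
Variable R : comUnitRingType.

Lemma prefix_ideal m (x : 'I_m -> R) k : is_ideal (in_prefix_ideal x k).
Proof.
split; [|split].
- by exists (fun=> 0); rewrite big1 // => i _; rewrite mul0r.
- move=> _ _ [c ->] [d ->]; exists (fun i => c i + d i).
  by rewrite -big_split; apply: eq_bigr => i _; rewrite mulrDl.
- move=> r _ [c ->]; exists (fun i => r * c i).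
  by rewrite big_distrr; apply: eq_bigr => i _; rewrite /= mulrA.
Qed.

Lemma prefix0 m (x : 'I_m -> R) y : in_prefix_ideal x 0 y <-> y = 0.
Proof.
split=> [[c ->]|->]; first by rewrite big_pred0.
exact: ideal0 (prefix_ideal x 0).
Qed.

Lemma prefixS m (x : 'I_m -> R) (k : 'I_m) y :
  in_prefix_ideal x k.+1 y <-> adj (in_prefix_ideal x k) (x k) y.
Proof.
have e c : \sum_(j < m | (j < k.+1)%N) c j * x j =
    c k * x k + \sum_(j < m | (j < k)%N) c j * x j.
  rewrite (bigD1 k) //=; congr (_ + _); apply: eq_bigl => j.
  by rewrite ltnS andbC ltn_neqAle.
split=> [[c ->]|/adjP [r [c hc]]].
  by apply/adjP; exists (c k); rewrite e addrC addKr; exists c.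
exists (fun j => if j == k then r else c j); rewrite e eqxx.
rewrite -(subrK (r * x k) y) hc addrC; congr (_ + _); apply: eq_bigr => j hj.
by case: eqP hj => // ->; rewrite ltnn.
Qed.

Variables (n : nat) (f : 'I_n -> R) (I : R -> Prop).
Hypotheses (hI : generated_by I f) (I1 : ~ I 1).

(** [j] counts the elements left after the first [k]. With none left, degrees above [n] are empty;
    each element put back lowers the bound by one. *)
Lemma regular_seq_hvan m (x : 'I_m -> R) : (forall i, I (x i)) -> regular_seq x ->
  forall j k i, (j + k = m)%N -> (n < i + j)%N -> hvan f (in_prefix_ideal x k) i.
Proof.
move=> hxI [hreg _]; elim=> [|j IH] k i hk hi.
  rewrite addn0 in hi; move=> c /(kdeg_big hi) -> _; exists 0; first exact: kdeg0.
  by rewrite linear0 subr0; apply: coefs0; apply: prefix_ideal.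
have hkm : (k < m)%N by rewrite -hk addSn ltnS leq_addl.
pose k' := Ordinal hkm.
apply: (@hvan_quotient _ _ _ _ (x k')); first exact: prefix_ideal.
- exact/hI.
- by move=> y; apply: (hreg k').
apply: (hvan_eq (prefixS x k')); apply: IH; first by rewrite addnS -addSn.
by rewrite addSnnS.
Qed.

Lemma regular_seq_size m (x : 'I_m -> R) :
  (forall i, I (x i)) -> regular_seq x -> (m <= n)%N.
Proof.
move=> hxI hx; rewrite leqNgt; apply/negP => hmn; apply: I1.
have II : is_ideal I.
  have -> : I = span f by apply: funext => w; apply: propext.
  exact: span_ideal.
have [||y _ /(_ set0)] := @regular_seq_hvan m x hxI hx m 0%N 0%N (addn0 m) hmn
   [ffun U : {set 'I_n} => ((U == set0)%:R : R^o)].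
- by move=> U; rewrite ffunE cards_eq0 => /negPf->.
- move=> U; apply/prefix0; rewrite sum_ffunE big1 // => p _; rewrite !ffunE.
  case: ifP => _; rewrite ?scaler0 //.
  rewrite (_ : (_ == set0) = false) ?mulr0 ?scaler0 //.
  by apply/negP => /eqP /setP /(_ p); rewrite !inE eqxx.
move=> /prefix0 /eqP; rewrite !ffunE eqxx subr_eq0 => /eqP e.
rewrite (e : 1 = dif f y set0) dif_set0; apply: ideal_sum => // p _; apply: idealMr => //.
exact: (generated_mem _ hI).
Qed.

(** [w] times the top basis vector is a cycle, so degree [n] survives modulo the whole sequence;
    each element removed moves the surviving degree down by one. *)
Lemma annihilator_not_hvan m (x : 'I_m -> R) w :
  (forall i, I (x i)) -> regular_seq x ->
  ~ in_prefix_ideal x m w -> (forall y, I y -> in_prefix_ideal x m (y * w)) ->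
  forall j k, (j + k = m)%N -> ~ hvan f (in_prefix_ideal x k) (n - j).
Proof.
move=> hxI hx hw hIw; elim=> [|j IH] k hk.
  rewrite add0n in hk; rewrite hk subn0 => hv; apply: hw.
  have [||y /(kdeg_big (ltnSn n)) ->] := hv [ffun U => if U == setT then w else 0 : R^o].
  - move=> U; rewrite ffunE; have [->|//] := eqVneq U setT.
    by rewrite cardsT card_ord eqxx.
  - move=> U; rewrite sum_ffunE; apply: ideal_sum; first exact: prefix_ideal.
    move=> p _; rewrite !ffunE; case: ifP => _; rewrite /GRing.scale /=.
      by rewrite mulr0; apply: ideal0 (prefix_ideal _ _).
    rewrite mulrCA; apply: idealMl; first exact: prefix_ideal.
    case: ifP => _; last by rewrite mulr0; apply: ideal0 (prefix_ideal _ _).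
    by apply: hIw; apply: (generated_mem _ hI).
  by rewrite linear0 subr0 => /(_ setT); rewrite ffunE eqxx.
have hkm : (k < m)%N by rewrite -hk addSn ltnS leq_addl.
have hmn := regular_seq_size hxI hx.
pose k' := Ordinal hkm.
have hjn : (n - j = (n - j.+1).+1)%N by move: hmn hk; lia.
move=> hv; apply: (IH k.+1); first by rewrite addnS -addSn.
have hreg : forall b, in_prefix_ideal x k (x k' * b) -> in_prefix_ideal x k b.
  by move=> b; apply: (hx.1 k').
rewrite hjn; apply: (@hvan_eq R n f (adj (in_prefix_ideal x k) (x k'))).
  by move=> a; rewrite (prefixS x k').
apply: hvan_quotientN => //; first exact: prefix_ideal.
by apply: (regular_seq_hvan hxI hx hk); move: hmn hk; lia.
Qed.

(** A sequence of maximal length cannot be prolonged, so every element of [I] is a zero divisor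
    modulo it; [common_annihilator] supplies one [w] killed by all of [I]. *)
Lemma grade_hvan g : noetherian R -> grade_is I g ->
  (g <= n)%N /\ ~ hvan f (fun a => a = 0) (n - g) /\
  forall i, (n < i + g)%N -> hvan f (fun a => a = 0) i.
Proof.
move=> hN [[x [hxI hx]] hmax].
have e0 a : in_prefix_ideal x 0 a <-> a = 0 by apply: prefix0.
split; first exact: regular_seq_size hx.
split; last first.
  by move=> i hi; apply: (hvan_eq e0); apply: (regular_seq_hvan hxI hx (addn0 g)).
have II : is_ideal I.
  have -> : I = span f by apply: funext => w; apply: propext.
  exact: span_ideal.
suff [w hw hIw] : exists2 w, ~ in_prefix_ideal x g w &
    forall y, I y -> in_prefix_ideal x g (y * w).
  move=> hv; apply: (annihilator_not_hvan hxI hx hw hIw (addn0 g)).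
  by apply: hvan_eq hv => a; rewrite e0.
apply: common_annihilator => //; first exact: prefix_ideal.
move=> y hy; apply: contrapT => hno.
pose x' (i : 'I_g.+1) := if unlift ord_max i is Some j then x j else y.
have x'l (j : 'I_g) : x' (lift ord_max j) = x j by rewrite /x' liftK.
have x'm : x' ord_max = y by rewrite /x' unlift_none.
have hlm (j : 'I_g) : lift ord_max j = j :> nat by rewrite /= /bump leqNgt ltn_ord.
have hlw (j : 'I_g) : widen_ord (leqnSn g) j = lift ord_max j 
  by apply: val_inj; rewrite /= /bump leqNgt ltn_ord.
have hpre k a : (k <= g)%N -> in_prefix_ideal x' k a <-> in_prefix_ideal x k a.
  move=> hk.
  have es c : \sum_(j < g.+1 | (j < k)%N) c j * x' j =
      \sum_(j < g | (j < k)%N) c (lift ord_max j) * x j.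
    rewrite big_mkcond big_ord_recr /= ltnNge hk addr0 [RHS]big_mkcond.
    by apply: eq_bigr => j _; rewrite hlw x'l.
  split=> -[c ->]; first by rewrite es; exists (fun j => c (lift ord_max j)).
  exists (fun i => if unlift ord_max i is Some j then c j else 0); rewrite es.
  by apply: eq_bigr => j _; rewrite liftK.
suff : (g.+1 <= g)%N by rewrite ltnn.
apply: (hmax _ x').
  by move=> i; case: (unliftP ord_max i) => [j|] ->; rewrite ?x'l ?x'm.
split.
  move=> i z; case: (unliftP ord_max i) => [j|] ->.
    rewrite x'l hlm !hpre; [exact: hx.1|exact: ltnW|exact: ltnW].
  rewrite x'm /= !hpre // => hz; apply: contrapT => hnz.
  by apply: hno; exists z.
move=> h1; apply: I1; case: h1 => c ->; apply: ideal_sum => // i _; apply: idealMl => //.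
by case: (unliftP ord_max i) => [j|] ->; rewrite ?x'l ?x'm.
Qed.

End Grade.

(** * Quasi-complete intersection ideals *)

Lemma iot_op (R : comUnitRingType) n p h (x : kff R n) :
  iot p (op h x) + op h (iot p x) = h p *: x.
Proof.
rewrite /op linear_sum -big_split /= (bigD1 p) //= big1 ?addr0 => [|q hq].
  by rewrite linearZ -scalerDr iot_eps eqxx scale1r.
by rewrite linearZ -scalerDr iot_eps eq_sym (negPf hq) scale0r scaler0.
Qed.

Lemma op_sum (R : comUnitRingType) n r (u : 'I_r -> R) (c : 'I_r -> 'I_n -> R)
    (x : kff R n) :
  op (fun p => \sum_j u j * c j p) x = \sum_j u j *: op (c j) x.
Proof.
rewrite /op; under [RHS]eq_bigr do rewrite scaler_sumr.
rewrite exchange_big; apply: eq_bigr => p _ /=.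
by rewrite scaler_suml; apply: eq_bigr => j _; rewrite scalerA.
Qed.

Section Qci.
Variables (R : comUnitRingType) (n : nat).

Definition vac : kff R n := tokff (@kone R n).

Lemma vac_deg : @kdeg R n 0 vac.
Proof. by move=> U; rewrite ffunE /kone -cards_eq0 => /negPf->. Qed.

Lemma dif_vac f : dif f vac = 0.
Proof.
apply/ffunP => U; rewrite /dif sum_ffunE !ffunE big1 // => p _; rewrite !ffunE /kone.
case: ifP => _; rewrite ?scaler0 //.
rewrite (_ : (_ == set0) = false) ?mulr0 ?scaler0 //.
by apply/negP => /eqP /setP /(_ p); rewrite !inE eqxx.
Qed.

Lemma op_vac h p : op h vac [set p] = h p.
Proof.
rewrite /op sum_ffunE (bigD1 p) //= big1 ?addr0 => [|q hq].
  rewrite !ffunE inE eqxx setDv /kone eqxx mulr1 /GRing.scale /=.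
  rewrite /sgn (_ : [set u in _ | _] = set0) ?cards0 ?expr0 ?mulr1 //.
  by apply/setP => u; rewrite !inE; case: eqP => //= ->; rewrite ltnn.
by rewrite !ffunE inE (negPf hq) scaler0.
Qed.

(** Ties the product in the definition of a q.c.i. ideal to [op]: only singletons contribute, and
    for them [ksign] reduces to [sgn]. *)
Lemma kmul_deg1 (y x : kelt R n) U : kdeg 1 y ->
  kmul y x U = op (fun p => y [set p]) (tokff x) U.
Proof.
move=> hy; rewrite /kmul (bigID (mem [set [set p] | p in U])) /=.
rewrite [X in _ + X]big1 ?addr0; last first.
  move=> A /andP [hA hA']; rewrite hy ?mulr0 ?mul0r //.
  apply: contra hA' => /cards1P [p hp]; apply/imsetP; exists p => //.
  by move: hA; rewrite hp sub1set.
rewrite (eq_bigl (mem [set [set p] | p in U])); last first.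
  move=> A /=; rewrite andb_idl // => /imsetP [p hp ->]; by rewrite sub1set.
rewrite big_imset /=; last by move=> p q _ _; apply: set1_inj.
rewrite /op sum_ffunE big_mkcond; apply: eq_bigr => p _.
rewrite !ffunE /GRing.scale /=; case: ifP => hp; rewrite ?mulr0 //.
rewrite mulrA [y _ * sgn _ _ _]mulrC; congr (_ * _ * _).
rewrite /ksign /sgn; congr (_ ^+ _).
have hinj : injective (fun u : 'I_n => (p, u)) by move=> a b [].
rewrite -[RHS](card_imset _ hinj); apply: eq_card => -[a b]; rewrite !inE /=.
apply/idP/imsetP => [/andP [/andP [/eqP -> /andP [hb1 hb2]] hb3]|[u]].
  by exists b; rewrite ?inE ?hb2.
rewrite !inE => /andP [hu1 hu2] [-> ->]; rewrite eqxx hu1 hu2 !andbT /=.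
by apply/eqP => e; move: hu2; rewrite e ltnn.
Qed.

Variables (r : nat) (c : 'I_r -> 'I_n -> R).

Definition zprod (l : seq 'I_r) : kff R n := foldr (fun j acc => op (c j) acc) vac l.
(** The algebra map from the exterior algebra on [r] generators that sends the j-th one to the
    vector [c j]. With [kff R r] as source, [eps], [iot] and [op] also act on the coefficients. *)
Definition zcomb (s : kff R r) : kff R n := \sum_U s U *: zprod (enum U).

Lemma zcomb_is_linear : linear zcomb.
Proof.
move=> a x y; rewrite /zcomb scaler_sumr -big_split; apply: eq_bigr => U _.
by rewrite !ffunE /= scalerDl -scalerA.
Qed.
HB.instance Definition _ := GRing.isLinear.Build R (kff R r) (kff R n) _ zcomb zcomb_is_linear.

Lemma op_zprod_filter l (W : {set 'I_r}) j :
  pairwise (fun a b : 'I_r => (a < b)%N) l -> j \in l ->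
  op (c j) (zprod [seq i <- l | i \in W]) =
  if j \in W then 0 else
    (-1) ^+ count (fun u => (u \in W) && (u < j)%N) l *: zprod [seq i <- l | i \in j |: W].
Proof.
elim: l => // h l IH /= /andP [hl hp]; rewrite inE => /orP [/eqP ->|hj].
  rewrite setU11 ltnn andbF /= add0n.
  have [hW|hW] := boolP (h \in W); first by rewrite /= opK.
  rewrite (@eq_in_count _ _ pred0) => [|u hu /=]; last first.
    by have := allP hl _ hu; case: ltngtP => //; rewrite andbF.
  rewrite count_pred0 expr0 scale1r; congr (op _ (zprod _)).
  apply: eq_in_filter => u hu; rewrite !inE; case: eqP => // e.
  by have := allP hl _ hu; rewrite e ltnn.
have hhj := allP hl _ hj.
have hhj' : (h == j) = false by apply/eqP => e; move: hhj; rewrite e ltnn.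
rewrite in_setU1 hhj' hhj andbT /=; have [hW|hW] := boolP (h \in W); last exact: IH.
rewrite /= op_op IH //; case: ifP => _; first by rewrite linear0 oppr0.
by rewrite linearZ /= exprS mulN1r scaleNr.
Qed.

Lemma op_zprod (W : {set 'I_r}) j :
  op (c j) (zprod (enum W)) =
  if j \in W then 0 else sgn R j W *: zprod (enum (j |: W)).
Proof.
have hs : pairwise (fun a b : 'I_r => (a < b)%N) (enum 'I_r).
  rewrite -sorted_pairwise; last by move=> a b d; apply: ltn_trans.
  rewrite -(@sorted_map _ _ val ltn) val_enum_ord; exact: iota_ltn_sorted.
have e (V : {set 'I_r}) : enum V = [seq i <- enum 'I_r | i \in V].
  by rewrite enumT /enum_mem; apply: eq_filter.
rewrite !e op_zprod_filter ?mem_enum //; case: ifP => // _; congr (_ ^+ _ *: _).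
by rewrite cardE e size_filter; apply: eq_count => u; rewrite inE.
Qed.

Lemma zcomb_eps j s : zcomb (eps j s) = op (c j) (zcomb s).
Proof.
rewrite /zcomb linear_sum /=.
rewrite (bigID (fun U : {set 'I_r} => j \in U)) /= [X in _ + X]big1 ?addr0; last first.
  by move=> U /negPf hU; rewrite ffunE hU scale0r.
rewrite [RHS](bigID (fun U : {set 'I_r} => j \in U)) /= [X in _ = X + _]big1 ?add0r; last first.
  by move=> U hU; rewrite linearZ /= op_zprod hU scaler0.
rewrite (reindex_onto (fun U => j |: U) (fun U => U :\ j)) /=; last by move=> U; apply: setD1K.
apply: eq_big => [U|U /andP [_ /eqP hU]].
  rewrite setU11 /=; apply/eqP/idP => [<-|h]; first by rewrite setD11.
  exact: setU1K.
have hjU : j \notin U by rewrite -hU setD11.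
rewrite ffunE setU11 setU1K // linearZ /= op_zprod (negPf hjU) scalerA.
by rewrite sgn_add // ltnn expr0 mul1r mulrC.
Qed.

Lemma zcomb_op u s : zcomb (op u s) = op (fun p => \sum_j u j * c j p) (zcomb s).
Proof.
rewrite op_sum {1}/op linear_sum; apply: eq_bigr => j _ /=.
by rewrite linearZ /= zcomb_eps.
Qed.

Lemma zprod_deg l : @kdeg R n (size l) (zprod l).
Proof. by elim: l => [|j l IH]; [exact: vac_deg|exact: op_deg]. Qed.

Lemma zcomb_deg i (s : kff R r) : @kdeg R r i s -> @kdeg R n i (zcomb s).
Proof.
move=> hs; apply: kdeg_sum => U _; have [<-|h] := eqVneq #|U| i.
  by apply: kdegZ; rewrite cardE; apply: zprod_deg.
by rewrite hs // scale0r; apply: kdeg0.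
Qed.

Lemma kcombE (z : 'I_r -> kelt R n) i s V : (forall j, kdeg 1 (z j)) ->
  (forall j p, z j [set p] = c j p) ->
  kcomb i z s V = zcomb [ffun U : {set 'I_r} => if #|U| == i then s U else 0 : R^o] V.
Proof.
move=> hz hc; rewrite /kcomb /zcomb sum_ffunE big_mkcond; apply: eq_bigr => U _.
rewrite !ffunE; case: ifP => _; rewrite ?scale0r ?ffunE // /GRing.scale /=.
congr (_ * _).
suff h (l : seq 'I_r) W : foldr (fun j acc => kmul (z j) acc) (kone R (n:=n)) l W =
   zprod l W by apply: h.
elim: l W => [|j l IH] W; first by rewrite ffunE.
rewrite /= kmul_deg1 //; rewrite (_ : tokff _ = zprod l).
  by rewrite /op !sum_ffunE; apply: eq_bigr => p _; rewrite !ffunE hc.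
by apply/ffunP => W'; rewrite ffunE IH.
Qed.

Variable f : 'I_n -> R.
Hypothesis hcf : forall j, \sum_p c j p * f p = 0.

Lemma dif_zprod l : dif f (zprod l) = 0.
Proof.
elim: l => [|j l IH] /=; first exact: dif_vac.
have := dif_op f (c j) (zprod l).
by rewrite IH linear0 addr0 hcf scale0r.
Qed.

Lemma dif_zcomb s : dif f (zcomb s) = 0.
Proof.
by rewrite /zcomb linear_sum big1 // => U _; rewrite linearZ /= dif_zprod scaler0.
Qed.

(** The ideal of [f] kills homology: a coefficient that is the value of [h] at [f] is absorbed by
    applying [op h] to the cycle. *)
Lemma zcomb_boundary i (s : kff R r) : @kdeg R r i s -> (forall U, span f (s U)) ->
  exists2 y : kff R n, @kdeg R n i.+1 y & zcomb s = dif f y.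
Proof.
move=> hs /choice [h hh].
exists (\sum_(U : {set 'I_r} | #|U| == i) op (h U) (zprod (enum U))).
  apply: kdeg_sum => U /eqP <-; apply: op_deg; rewrite cardE; exact: zprod_deg.
rewrite linear_sum /zcomb [RHS]big_mkcond; apply: eq_bigr => U _.
case: eqP => /eqP hU; last by rewrite hs // scale0r.
by rewrite hh -(@dif_op R n) dif_zprod linear0 addr0.
Qed.

End Qci.

Section QciExact.
Variables (R : comUnitRingType) (n : nat) (f : 'I_n -> R) (r : nat) (z : 'I_r -> kelt R n).
Let I := span f.
Hypothesis hz : forall j, kcycle f 1 (z j).
Hypothesis hspan : forall i c, kcycle f i c -> exists s : {set 'I_r} -> R,
           kboundary f i (fun V => c V - kcomb i z s V).
Hypothesis hfree : forall i (s : {set 'I_r} -> R), kboundary f i (kcomb i z s) ->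
         forall U : {set 'I_r}, #|U| = i -> I (s U).

Definition zcoef (j : 'I_r) (p : 'I_n) : R := z j [set p].

Lemma zcoef_cycle j : \sum_p zcoef j p * f p = 0.
Proof.
have [_ /(_ set0)] := hz j; rewrite kdiffE dif_set0 => e.
by rewrite -[RHS]e; apply: eq_bigr => p _; rewrite ffunE mulrC.
Qed.

Lemma qci_span i (x : kff R n) : @kdeg R n i x -> dif f x = 0 ->
  exists (s : kff R r) (y : kff R n), [/\ @kdeg R r i s, @kdeg R n i.+1 y & x = zcomb zcoef s + dif f y].
Proof.
move=> hx hdx; have [|s [y [hy hs]]] := @hspan i (fun V => x V).
  by split=> // U; rewrite kdiff_kff hdx ffunE.
exists [ffun U : {set 'I_r} => if #|U| == i then s U else 0 : R^o], (tokff y); split.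
- by move=> U /negPf hU; rewrite ffunE hU.
- by move=> U hU; rewrite ffunE; apply: hy.
apply/ffunP => V; rewrite ffunE -kdiffE -hs -(@kcombE _ _ _ _ z) //; last by move=> j; case: (hz j).
by rewrite addrC subrK.
Qed.

Lemma qci_free i (s : kff R r) (y : kff R n) : @kdeg R r i s -> @kdeg R n i.+1 y ->
  zcomb zcoef s = dif f y -> forall U, I (s U).
Proof.
move=> hs hy e U; have [hU|hU] := eqVneq #|U| i; last first.
  by rewrite hs //; apply: ideal0; apply: span_ideal.
apply: (hfree _ hU); exists y; split=> // V; rewrite kdiff_kff -e.
rewrite (@kcombE _ _ _ zcoef) //; last by move=> j; case: (hz j).
congr (zcomb _ _ V); apply/ffunP => W; rewrite ffunE; case: eqP => // /eqP h.
by rewrite hs.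
Qed.

(* Contraction against the j-th basis vector is a homotopy from multiplication by z to u j. *)
Lemma qci_exact (u : 'I_r -> R) j i (x y : kff R n) :
  u j \is a GRing.unit -> @kdeg R n i x -> dif f x = 0 ->
  @kdeg R n i.+2 y -> op (fun p => \sum_j u j * zcoef j p) x = dif f y ->
  exists w v : kff R n, [/\ forall U : {set 'I_n}, #|U|.+1 != i -> w U = 0, @kdeg R n i.+1 v,
    dif f w = 0 & x = op (fun p => \sum_j u j * zcoef j p) w + dif f v].
Proof.
move=> huj hx hdx hy hxy; set Z := op _ in hxy *.
have ZD a : dif f (Z a) = - Z (dif f a).
  apply/eqP; rewrite -addr_eq0 dif_op (_ : \sum_p _ = 0) ?scale0r //.
  under eq_bigr do rewrite big_distrl.
  rewrite exchange_big big1 //= => k _; under eq_bigr do rewrite -mulrA.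
  by rewrite -big_distrr /= zcoef_cycle mulr0.
have ZL a b : Z (a + b) = Z a + Z b by apply: (linearD (op _)).
have [s [y1 [hs hy1 ex]]] := qci_span hx hdx.
have hus : @kdeg R r i.+1 (op u s) by apply: op_deg.
have hI := @qci_free i.+1 (op u s) (y + Z y1) hus.
have {}hI U : I (op u s U).
  apply: hI; first by apply: kdegD => //; apply: op_deg.
  by rewrite zcomb_op -/Z (linearD (dif f)) /= -hxy ex ZD ZL addrK.
(* The homotopy splits [s] into [op u t], which gives the multiple of z, and [e], whose coefficients
   lie in [I] since those of [op u s] do, so that it contributes a boundary. *)
pose t := (u j)^-1 *: iot j s; pose e := (u j)^-1 *: iot j (op u s).
have es : s = e + op u t.
  by rewrite /e /t linearZ /= -scalerDr iot_op scalerA mulVr // scale1r.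
have he : @kdeg R r i e by apply: kdegZ; apply: iot_deg.
have [|v0 hv0 ev0] := zcomb_boundary zcoef_cycle he.
  move=> U; rewrite !ffunE; apply: idealMl; first exact: span_ideal.
  case: ifP => _; first exact: ideal0 (span_ideal f).
  by apply: idealMl; [exact: span_ideal|exact: hI].
exists (zcomb zcoef t), (v0 + y1); split.
(* The degree condition is written with a successor so that for [i = 0] it says [w = 0]; the
   contraction does vanish there. *)
- case: i hs {hx hy hy1 hus he hv0 ex es} => [|i] hs U.
    move=> _; rewrite (_ : t = 0) ?linear0 ?ffunE //.
    apply/ffunP => V; rewrite !ffunE; case: ifP => h; rewrite ?scaler0 //.
    by rewrite hs ?mulr0 ?scaler0 // cardsU1 h.
  by rewrite eqSS => hU; apply: (@zcomb_deg R n r zcoef i) => //; apply: kdegZ; apply: iot_deg.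
- exact: kdegD.
- exact: dif_zcomb zcoef_cycle _.
by rewrite ex {1}es linearD /= ev0 zcomb_op -/Z (linearD (dif f)) /= addrAC addrC.
Qed.

Lemma qci_hvan_above i : (r < i)%N -> hvan f (fun a => a = 0) i.
Proof.
move=> hi x hx hdx.
have hdx0 : dif f x = 0 by apply/ffunP => U; rewrite ffunE; apply: hdx.
have [s [y [hs hy ex]]] := qci_span hx hdx0.
exists y => // U; rewrite ex (kdeg_big hi hs) linear0 add0r subrr ffunE //.
Qed.

Lemma qci_not_hvan : ~ I 1 -> ~ hvan f (fun a => a = 0) r.
Proof.
move=> hI1 hv; apply: hI1.
(* The product of all the cycles: a basis element in degree [r], which bounds only if 1 is in
   [I]. *)
pose s : kff R r := [ffun U => (U == setT)%:R : R^o].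
have hs : @kdeg R r r s.
  move=> U; rewrite ffunE; have [->|//] := eqVneq U setT.
  by rewrite cardsT card_ord eqxx.
have [||y hy e] := hv (zcomb zcoef s); first exact: zcomb_deg.
  by move=> U; rewrite dif_zcomb ?ffunE //; apply: zcoef_cycle.
have := @qci_free r s y hs hy _ setT; rewrite ffunE eqxx; apply.
by apply/eqP; rewrite -subr_eq0; apply/eqP/ffunP => U; rewrite e ffunE.
Qed.

Lemma qci_grade g : noetherian R -> ~ I 1 -> grade_is I g -> n = (r + g)%N.
Proof.
move=> hN hI1 hg.
have hgen : generated_by I f by [].
have [hgn [h1 h2]] := grade_hvan hgen hI1 hN hg.
have h3 : ~~ (n < r + g)%N by apply/negP => /h2; apply: qci_not_hvan.
have h4 : ~~ (r < n - g)%N by apply/negP => /qci_hvan_above.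
by move: h3 h4 hgn; lia.
Qed.

End QciExact.

(** * Adjoining a divided power variable *)

Section PairOps.
Variables (R : comUnitRingType) (V : lmodType R).

(** A pair stands for [u.1 + e u.2], where e is a new exterior variable with differential [a]; the
    minus sign comes from passing e. The operators below follow the same convention. *)
Definition pair_d (d : {linear V -> V}) (a : R) (u : (V * V)%type) : V * V :=
  (d u.1 + a *: u.2, - d u.2).
Lemma pair_d_linear d a : linear (pair_d d a).
Proof.
move=> b u v; rewrite /pair_d /= !linearP /=; congr (_, _).
by rewrite /= scalerDr addrACA.
Qed.
HB.instance Definition _ d a :=
  GRing.isLinear.Build R (V * V)%type (V * V)%type _ (pair_d d a) (pair_d_linear d a).

Definition pair_e (e : {linear V -> V}) (u : (V * V)%type) : V * V := (e u.1, - e u.2).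
Lemma pair_e_linear e : linear (pair_e e).
Proof.
by move=> b u v; rewrite /pair_e /= !linearP /=; congr (_, _); rewrite /= opprD scalerN.
Qed.
HB.instance Definition _ e :=
  GRing.isLinear.Build R (V * V)%type (V * V)%type _ (pair_e e) (pair_e_linear e).

Definition pair_new (u : (V * V)%type) : V * V := (0, u.1).
Lemma pair_new_linear : linear pair_new.
Proof. by move=> b u v; rewrite /pair_new /=; congr (_, _); rewrite /= scaler0 addr0. Qed.
HB.instance Definition _ :=
  GRing.isLinear.Build R (V * V)%type (V * V)%type _ pair_new pair_new_linear.

Definition pair_aug (g : {linear V -> R^o}) (u : (V * V)%type) : R^o := g u.1.
Lemma pair_aug_linear g : linear (pair_aug g).
Proof. by move=> b u v; rewrite /pair_aug /= linearP. Qed.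
HB.instance Definition _ g :=
  GRing.isLinear.Build R (V * V)%type R^o _ (pair_aug g) (pair_aug_linear g).
End PairOps.

Section Tower.
Variables (R : comUnitRingType) (T : finType) (f : T -> R) (m : R -> Prop).
Hypothesis mI : is_ideal m.
Hypothesis fm : forall p, m (f p).

(* A complex with operators modelled on multiplication by the exterior variables of a
   Koszul complex; only the variables in act are bound to the given f. *)
Record kosz (act : pred T) := Kosz {
  kV : lmodType R;
  kdg : int -> kV -> Prop;
  kd : {linear kV -> kV};
  ke : T -> {linear kV -> kV};
  k1 : kV;
  kaug : {linear kV -> R^o};
  kdgP : forall d a x y, kdg d x -> kdg d y -> kdg d (a *: x + y);
  kdg0 : forall d, kdg d 0;
  kd_dg : forall d x, kdg d x -> kdg (d - 1) (kd x);
  ke_dg : forall p d x, kdg d x -> kdg (d + 1) (ke p x);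
  kdd : forall x, kd (kd x) = 0;
  kcar : forall p x, act p -> kd (ke p x) + ke p (kd x) = f p *: x;
  kac : forall p q x, ke p (ke q x) = - ke q (ke p x);
  kee : forall p x, ke p (ke p x) = 0;
  k1_dg : kdg 0 k1;
  kd1 : kd k1 = 0;
  kaug1 : kaug k1 = 1;
  kaugd : forall x, m (kaug (kd x)) }.

Definition zop act (K : kosz act) (c : T -> R) (x : kV K) : kV K := \sum_p c p *: ke K p x.

(* The complex K<w | dw = z>: the coefficient of the i-th divided power of w is t i. *)
Definition acyclic_above act (K : kosz act) (c : T -> R) (k : int) :=
  forall d : int, (k < d)%R -> forall t : nat -> kV K,
  (forall i : nat, kdg (d - (i%:Z + i%:Z)) (t i)) ->
  (forall i, kd K (t i) + zop c (t i.+1) = 0) ->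
  exists2 s : nat -> kV K, (forall i : nat, kdg (d + 1 - (i%:Z + i%:Z)) (s i)) &
    forall i, kd K (s i) + zop c (s i.+1) = t i.

Lemma zop_is_linear act (K : kosz act) c : linear (@zop act K c).
Proof.
move=> a x y; rewrite /zop scaler_sumr -big_split; apply: eq_bigr => p _ /=.
by rewrite linearP scalerDr !scalerA mulrC.
Qed.
HB.instance Definition _ act (K : kosz act) c :=
  GRing.isLinear.Build R (kV K) (kV K) _ (@zop act K c) (@zop_is_linear act K c).

Section Pair.
Variables (act : pred T) (K : kosz act) (q : T).
Let V := kV K.
Let pe (p : T) : {linear (V * V)%type -> (V * V)%type} :=
  if p == q then (@pair_new R V : {linear (V * V)%type -> (V * V)%type}) else pair_e (ke K p).
Let pdg (d : int) (u : (V * V)%type) := kdg d u.1 /\ kdg (d - 1) u.2.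

Definition kosz_pair : kosz [pred p | (p == q) || act p].
Proof.
refine (@Kosz _ (V * V)%type pdg (pair_d (kd K) (f q)) pe (k1 K, 0)
   (pair_aug (kaug K)) _ _ _ _ _ _ _ _ _ _ _ _).
- by move=> d a x y [h1 h2] [h3 h4]; split; apply: kdgP.
- by move=> d; split; apply: kdg0.
- move=> d x [h1 h2]; split=> /=.
    by rewrite [X in kdg _ X]addrC; apply: kdgP => //; apply: kd_dg.
  by rewrite -scaleN1r -[_ *: _]addr0; apply: kdgP; [exact: kd_dg|exact: kdg0].
- move=> p d x [h1 h2]; rewrite /pe; case: eqP => _; split=> /=.
  + exact: kdg0.
  + by rewrite addrK.
  + exact: ke_dg.
  + rewrite -scaleN1r -[_ *: _]addr0; apply: kdgP; last exact: kdg0.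
    by rewrite addrAC; apply: ke_dg.
- move=> x; rewrite /= /pair_d /= linearD linearZ !linearN /= !kdd.
  by rewrite add0r subrr opprK.
- move=> p x; rewrite /= /pe; case: eqP => [->|_] /= hp; rewrite /pair_d /pair_new /pair_e /=.
    by congr (_, _); rewrite /= ?linear0 ?add0r ?addr0 // addrA addNr add0r.
  congr (_, _) => /=.
    rewrite linearD linearZ /= scalerN addrACA [- _ + _]addrC subrr addr0; exact: kcar.
  by rewrite !linearN /= !opprK; apply: kcar.
- move=> p p' x; rewrite /pe; case: eqP => _; case: eqP => _ /=;
    rewrite /pair_new /pair_e /=; congr (_, _) => /=;
    rewrite ?linear0 ?oppr0 ?opprK //; try by rewrite kac.
  by rewrite !linearN /= !opprK kac.
- move=> p x; rewrite /pe; case: eqP => _ /=; rewrite /pair_new /pair_e //=.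
  by rewrite linearN !kee /= !oppr0.
- by split; [exact: k1_dg|exact: kdg0].
- by rewrite /= /pair_d /= kd1 !linear0 ?scaler0 ?addr0 ?oppr0.
- exact: kaug1.
- move=> x; rewrite /= /pair_aug /= linearD linearZ /=; apply: idealD => //; first exact: kaugd.
  by apply: idealMr.
Defined.

(** The second components solve the same problem in degree [d - 1], whence the shift of the bound;
    their solution, times [f q], corrects the equation for the first components. As [c q = 0],
    multiplication by [c] acts componentwise up to sign. *)
Lemma acyclic_pair c k : c q = 0 -> acyclic_above K c k ->
  acyclic_above kosz_pair c (k + 1).
Proof.
move=> hcq hK d hd t ht hDt.
have hz (u : (V * V)%type) : @zop _ kosz_pair c u = (zop c u.1, - zop c u.2).
  rewrite /zop /=; transitivity (\sum_p ((c p *: ke K p u.1, c p *: (- ke K p u.2)) : (V * V)%type)).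
    apply: eq_bigr => p _; rewrite /pe; case: eqP => [->|_] //.
    by rewrite hcq !scale0r.
  rewrite -sumrN; elim/big_rec3: _ => [|p y1 y2 y3 _ ->] //.
  by rewrite scalerN.
pose a i := (t i).1; pose b i := (t i).2.
have hDt1 i : kd K (a i) + f q *: b i + zop c (a i.+1) = 0.
  by have := congr1 fst (hDt i); rewrite hz.
have hDt2 i : kd K (b i) + zop c (b i.+1) = 0.
  have := congr1 snd (hDt i); rewrite hz /= => /eqP.
  by rewrite -opprD oppr_eq0 => /eqP.
have [|||b' hb1 hb2] := hK (d - 1) _ b; first by lia.
- by move=> i; have [_] := ht i; congr (kdg _ _); lia.
- exact: hDt2.
have [|||a' ha1 ha2] := hK d _ (fun i => a i + f q *: b' i); first by lia.
- move=> i; rewrite [X in kdg _ X]addrC; apply: kdgP; last by case: (ht i).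
  by have := hb1 i; congr (kdg _ _); lia.
- move=> i; rewrite !linearD !linearZ /= addrACA -scalerDr hb2 -[RHS](hDt1 i).
  by rewrite addrAC.
exists (fun i => (a' i, - b' i)).
  move=> i; split=> /=; first exact: ha1.
  rewrite -scaleN1r -[_ *: _]addr0; apply: kdgP; last exact: kdg0.
  by have := hb1 i; congr (kdg _ _); lia.
move=> i; rewrite hz /= /pair_d /= !linearN /= !opprK.
rewrite [RHS]surjective_pairing -/(a i) -/(b i); congr (_, _) => /=.
  by rewrite addrAC ha2 addrK.
by rewrite hb2.
Qed.
End Pair.

Lemma acyclic_activate (l : seq T) act (K : kosz act) c k :
  {in l, forall q, c q = 0} -> acyclic_above K c k ->
  exists (act' : pred T) (K' : kosz act') k',
    (forall p, act p || (p \in l) -> act' p) /\ acyclic_above K' c k'.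
Proof.
elim: l act K k => [|q l IH] act K k hl hK.
  by exists act, K, k; split=> // p; rewrite orbF.
have [||act' [K' [k' [h1 h2]]]] := IH _ (kosz_pair K q) (k + 1).
- by move=> p hp; apply: hl; rewrite inE hp orbT.
- by apply: acyclic_pair => //; apply: hl; rewrite inE eqxx.
exists act', K', k'; split=> // p hp; apply: h1.
by move: hp; rewrite !inE /= orbCA orbA.
Qed.

Lemma eq_acyclic act (K : kosz act) c c' k : c =1 c' ->
  acyclic_above K c k -> acyclic_above K c' k.
Proof. by move=> /funext ->. Qed.

(** With z = 0 each divided power of w is a cycle. If one bounded, [k1] would be a value of [kd],
    and its augmentation 1 would lie in [m]. *)
Lemma acyclic_zero act (K : kosz act) k : ~ m 1 -> ~ acyclic_above K (fun=> 0) k.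
Proof.
move=> m1 hK; apply: m1.
have hz0 x : @zop act K (fun=> 0) x = 0.
  by rewrite /zop big1 // => p _; rewrite scale0r.
pose N := (`|k|%N).+1.
have [|||s hs1 hs2] := hK (N%:Z + N%:Z) _ (fun i => if i == N then k1 K else 0).
- by rewrite /N; lia.
- move=> i; case: eqP => [->|_]; last exact: kdg0.
  by rewrite subrr; apply: k1_dg.
- by move=> i; rewrite hz0 addr0; case: eqP => _; rewrite ?kd1 ?linear0.
have := hs2 N; rewrite hz0 addr0 eqxx => e.
by have := kaugd (s N); rewrite e kaug1.
Qed.

(* Conjugating the differential by 1 + a e_p e_q changes z by the boundary of a e_p e_q;
   no divided powers of a e_p e_q occur because its square vanishes. *)
Lemma acyclic_move act (K : kosz act) c k a p q : act p -> act q ->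
  acyclic_above K c k ->
  acyclic_above K (fun u => c u + a * (f p * (u == q)%:R - f q * (u == p)%:R)) k.
Proof.
move=> hp hq hK; set c' := fun u => _.
pose mm x := a *: ke K p (ke K q x).
have mD x y : mm (x + y) = mm x + mm y by rewrite /mm !linearD.
have mN x : mm (- x) = - mm x by rewrite /mm !linearN.
have mmm x : mm (mm x) = 0.
  by rewrite /mm !linearZ /= (kac p q x) linearN /= linearN /= kee linear0 oppr0 !scaler0.
have hz x : zop c' x = zop c x + (kd K (mm x) - mm (kd K x)).
  have -> : kd K (mm x) - mm (kd K x) = a *: (f p *: ke K q x - f q *: ke K p x).
    rewrite /mm linearZ /= -scalerBr; congr (_ *: _).
    have e1 := kcar (ke K q x) hp; have e2 := kcar x hq.
    rewrite -e1 -[f q *: _]linearZ -e2 linearD /= opprD addrA addrK.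
    by [].
  rewrite /zop /c'; under eq_bigr do rewrite scalerDl.
  rewrite big_split /=; congr (_ + _).
  under eq_bigr do rewrite -scalerA scalerBl -!scalerA scalerBr.
  rewrite sumrB scalerBr; congr (_ - _).
    rewrite (bigD1 q) //= eqxx scale1r big1 ?addr0 // => u /negPf->.
    by rewrite scale0r !scaler0.
  rewrite (bigD1 p) //= eqxx scale1r big1 ?addr0 // => u /negPf->.
  by rewrite scale0r !scaler0.
have hzm x : zop c (mm x) = mm (zop c x).
  rewrite /zop /mm !linear_sum; apply: eq_bigr => u _ /=.
  rewrite !linearZ /= !scalerA mulrC; congr (_ *: _).
  by rewrite kac [ke K u (ke K q x)]kac linearN /= opprK.
have epqp x : ke K p (ke K q (ke K p x)) = 0 by rewrite (kac q p x) linearN /= kee oppr0.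
have mdm x : mm (kd K (mm x)) = 0.
  rewrite /mm !linearZ /=.
  have -> : kd K (ke K p (ke K q x)) = f p *: ke K q x - ke K p (kd K (ke K q x)).
    by rewrite -(kcar (ke K q x) hp) addrK.
  by rewrite !linearB /= !linearZ /= kee epqp !(linear0, scaler0, oppr0, addr0).
have hz'm x : zop c' (mm x) = mm (zop c x).
  by rewrite hz hzm mmm mdm linear0 subr0 addr0.
have mz x : mm (zop c' x) = mm (zop c x).
  by rewrite hz !mD mN mdm mmm subr0 addr0.
move=> d hd t ht hDt.
have mdg (e : int) x : kdg e x -> kdg (e + 2) (mm x).
  move=> hx; rewrite /mm -[_ *: _]addr0; apply: kdgP; last exact: kdg0.
  have := ke_dg p (ke_dg q hx); congr (kdg _ _); lia.
(* The coefficients after substituting w + a e_p e_q for w; the square being zero, only two terms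
   appear. The inverse substitution brings the solution back. *)
have [||s hs1 hs2] := hK d hd (fun i => t i + mm (t i.+1)).
- move=> i; rewrite -[t i]scale1r; apply: kdgP => //.
  by have := mdg _ _ (ht i.+1); congr (kdg _ _); lia.
- move=> i; rewrite !linearD /= hzm.
  have e1 := hDt i; have e2 := congr1 mm (hDt i.+1).
  have e3 : mm (zop c (t i.+2)) = - mm (kd K (t i.+1)).
    apply/eqP; rewrite -addr_eq0 addrC -mz -mD e2.
    by rewrite /mm !linear0.
  by rewrite e3 -[RHS]e1 hz -!addrA; congr (_ + _); rewrite addrCA.
exists (fun i => s i - mm (s i.+1)).
  move=> i; rewrite [X in kdg _ X]addrC -scaleN1r; apply: kdgP => //.
  by have := mdg _ _ (hs1 i.+1); congr (kdg _ _); lia.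
move=> i; rewrite !linearB /= hz'm hz.
have e := congr1 mm (hs2 i.+1); rewrite !mD mmm addr0 in e.
rewrite [zop c _ + _]addrCA -!addrA addKr addrCA.
rewrite -[RHS](addrK (mm (t i.+1))) -(hs2 i) -e opprD -!addrA; congr (_ + _).
by rewrite addrCA.
Qed.

End Tower.

(** * The Koszul complex of f with its divided power variable *)

Section Base.
Variables (R : comUnitRingType) (m : R -> Prop) (n e : nat).
Variables (f0 : 'I_n -> R) (x0 : 'I_e -> R).
Hypotheses (mI : is_ideal m) (f0m : forall i, m (f0 i)).
Let T : finType := ('I_n + 'I_e)%type.
Let F (p : T) : R := match p with inl i => f0 i | inr k => x0 k end.
Let V := kff R n.

Definition kff_aug (x : V) : R^o := x set0.
Lemma kff_aug_linear : linear kff_aug.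
Proof. by move=> a x y; rewrite /kff_aug !ffunE. Qed.
HB.instance Definition _ := GRing.isLinear.Build R V R^o _ kff_aug kff_aug_linear.

(** The variables of [x0] act as zero until they are activated; indexing by [T] from the start keeps
    one type for the coefficient vectors. *)
Let ke0 (p : T) : {linear V -> V} :=
  match p with inl i => (@eps R n i : {linear V -> V})
             | inr _ => (@GRing.null_fun V V : {linear V -> V}) end.
Let kdg0 (d : int) (x : V) := forall U : {set 'I_n}, (#|U|%:Z != d) -> x U = 0.

Definition kosz_base : kosz F m (fun p : T => if p is inl _ then true else false).
Proof.
refine (@Kosz R T F m _ V kdg0 (dif f0) ke0 (vac R n) kff_aug _ _ _ _ _ _ _ _ _ _ _ _).
- by move=> d a x y hx hy U hU; rewrite !ffunE hx // hy // scaler0 addr0.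
- by move=> d U _; rewrite ffunE.
- move=> d x hx U hU; rewrite sum_ffunE big1 // => p _; rewrite !ffunE; case: ifP => h.
    by rewrite scaler0.
  by rewrite hx ?mulr0 ?scaler0 // cardsU1 h; move: hU; lia.
- move=> [p|p] d x hx U hU; last by rewrite ffunE.
  rewrite ffunE; case: ifP => // h; rewrite hx ?mulr0 //.
  move: hU; rewrite (cardsD1 p U) h; move: #|U :\ p| => N; lia.
- by move=> x; apply: dif_dif.
- by move=> [p|p] x // _; apply: dif_eps.
- by move=> [p|p] [q|q] x; rewrite /= ?linear0 ?oppr0 //; apply: epsC.
- by move=> [p|p] x; rewrite //=; apply: epsK.
- move=> U hU; apply: vac_deg; by move: hU; lia.
- exact: dif_vac.
- by rewrite /= /kff_aug ffunE /kone eqxx.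
- move=> x; rewrite /= /kff_aug dif_set0; apply: ideal_sum => // p _; exact: idealMr.
Defined.

Variable c0 : 'I_n -> R.
Hypothesis c0f : \sum_i c0 i * f0 i = 0.
Hypothesis exact0 : forall i (x y : V), @kdeg R n i x -> dif f0 x = 0 ->
  @kdeg R n i.+2 y -> op c0 x = dif f0 y ->
  exists w v : V, [/\ forall U : {set 'I_n}, #|U|.+1 != i -> w U = 0, @kdeg R n i.+1 v,
    dif f0 w = 0 & x = op c0 w + dif f0 v].

Let c (p : T) : R := if p is inl i then c0 i else 0.

(** Exactness of multiplication by z on homology lets a boundary clear the coefficient of the
    highest power of w. What is left in the end has degree above [n], hence is zero. *)
Lemma kosz_base_acyclic : acyclic_above kosz_base c n%:Z.
Proof.
move=> d hd t ht hDt.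
have hz (x : V) : @zop _ _ _ _ _ kosz_base c x = op c0 x.
  rewrite /zop big_sumType /= [X in _ + X]big1 ?addr0 // => p _.
  by rewrite scaler0.
have [s hs1 hs2] : exists2 s : nat -> V, (forall i : nat, kdg0 (d + 1 - (i%:Z + i%:Z)) (s i)) &
    forall i, dif f0 (s i) + op c0 (s i.+1) = t i; last first.
  by exists s => // i; rewrite hz; apply: hs2.
have {hz}hDt i : dif f0 (t i : V) + op c0 (t i.+1 : V) = 0 by rewrite -hz; apply: hDt.
have ZD a : dif f0 (op c0 a) = - op c0 (dif f0 a).
  by apply/eqP; rewrite -addr_eq0 dif_op c0f scale0r.
have [N hN] : exists N, forall i, (N < i)%N -> t i = 0 :> V.
  exists `|d|%N => i hi; apply/ffunP => U; rewrite ffunE; apply: (ht i).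
  by move: hi; lia.
have dgB a x y : kdg0 a x -> kdg0 a y -> kdg0 a (x - y).
  by move=> hx hy U hU; rewrite !ffunE hx // hy // subrr.
have dgD a x y : kdg0 a x -> kdg0 a y -> kdg0 a (x + y).
  by move=> hx hy U hU; rewrite !ffunE hx // hy // addr0.
have difdg a x : kdg0 a x -> kdg0 (a - 1) (dif f0 x) by apply: (@kd_dg _ _ _ _ _ kosz_base).
have opdg a x : kdg0 a x -> kdg0 (a + 1) (op c0 x).
  move=> hx U hU; rewrite sum_ffunE big1 // => p _; rewrite ffunE.
  by rewrite (@ke_dg _ _ _ _ _ kosz_base (inl p) a x) // scaler0.
have dg00 a : kdg0 a 0 by move=> U _; rewrite ffunE.
elim: N t ht hDt hN => [|N IH] t ht hDt hN.
  exists (fun=> 0) => // -[|i]; rewrite !linear0 addr0; last by rewrite hN.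
  apply/ffunP => U; rewrite ffunE; symmetry; apply: (ht 0%N).
  by move: (max_card U) hd; rewrite card_ord; lia.
have [[i hi]|hneg] : (exists i : nat, d - (N.+1%:Z + N.+1%:Z) = i%:Z) \/
    (d - (N.+1%:Z + N.+1%:Z) < 0)%R.
- case: (boolP (d - (N.+1%:Z + N.+1%:Z) < 0)%R) => h; first by right.
  by left; exists (absz (d - (N.+1%:Z + N.+1%:Z))%R); lia.
- have htN := ht N.+1; rewrite hi in htN.
  have hdt : dif f0 (t N.+1 : V) = 0 by have := hDt N.+1; rewrite (hN N.+2) // linear0 addr0.
  have [||||w [v [hw hv hdw etN]]] := @exact0 i (t N.+1) (- (t N : V)).
  + by move=> U hU; apply: htN; move: hU; lia.
  + exact: hdt.
  + by move=> U hU; rewrite ffunE (ht N) ?oppr0 //; move: hU hi; lia.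
  + by rewrite linearN; apply/eqP; rewrite -addr_eq0 addrC; apply/eqP; apply: hDt.
  (* As the top coefficient is [op c0 w + dif f0 v], the chain with [v] at [N.+1] and [w] at [N.+2]
     has a boundary that cancels it. *)
  pose g k : V := if k == N.+1 then v else if k == N.+2 then w else 0.
  pose Dg k := dif f0 (g k) + op c0 (g k.+1).
  have hg k : kdg0 (d + 1 - (k%:Z + k%:Z)) (g k).
    rewrite /g; case: eqP => [->|_]; last case: eqP => [->|_] //.
      by move=> U hU; apply: hv; move: hU hi; lia.
    by move=> U hU; apply: hw; move: hU hi; lia.
  have [|||s hs1 hs2] := IH (fun k => t k - Dg k).
  + move=> k; apply: dgB; first exact: ht.
    rewrite /Dg; apply: dgD.
      by have := difdg _ _ (hg k); congr (kdg0 _ _); lia.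
    by have := opdg _ _ (hg k.+1); congr (kdg0 _ _); lia.
  + move=> k; rewrite !linearB /= addrACA hDt add0r -opprD /Dg !linearD /= !ZD dif_dif opK.
    by rewrite !oppr0 add0r addr0 opprK subrr.
  + move=> k hk; rewrite /Dg /g.
    have [->|h1] := eqVneq k N.+1.
      by rewrite eqxx etN (gtn_eqF (ltnSn N.+1)) [X in _ - X]addrC subrr.
    have hk2 : (N.+1 < k)%N by rewrite ltn_neqAle eq_sym h1.
    rewrite hN // !eqSS (gtn_eqF hk) (gtn_eqF hk2) linear0 addr0.
    by case: ifP => _; rewrite ?hdw !linear0 addr0.
  exists (fun k => s k + g k) => k; first exact: dgD.
  by rewrite !linearD /= addrACA hs2 -/(Dg k) subrK.
- apply: IH => // k hk; have [->|h1] := eqVneq k N.+1.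
    by apply/ffunP => U; rewrite ffunE; apply: (ht N.+1); lia.
  by apply: hN; rewrite ltn_neqAle eq_sym h1.
Qed.

(** [g] and [B] exhibit z as a boundary: [g] gives the coefficients on mixed pairs of variables, [B]
    those on pairs of variables of [x0]. Removing it term by term leads to z = 0, against
    [acyclic_zero]. *)
Lemma koszul_boundary_absurd (g : 'I_n -> 'I_e -> R) (B : 'I_e -> 'I_e -> R) :
  ~ m 1 -> (forall k, m (x0 k)) -> (forall i, c0 i = \sum_k g i k * x0 k) ->
  alternating B -> (forall k, \sum_i g i k * f0 i = \sum_j B k j * x0 j) -> False.
Proof.
move=> m1 x0m hg [hB0 hBN] hB.
have Fm p : m (F p) by case: p => p /=.
have [|act [K [k [hact hK]]]] := @acyclic_activate _ _ _ _ mI Fm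
    [seq inr k | k <- enum 'I_e] _ kosz_base c n%:Z _ kosz_base_acyclic.
  by move=> _ /mapP [k _ ->].
have {}hact p : act p.
  by apply: hact; case: p => p //=; apply/mapP; exists p; rewrite ?mem_enum.
have moves (X : Type) (s : seq X) (a : X -> R) (p q : X -> T) c1 :
    acyclic_above K c1 k -> acyclic_above K (fun u => c1 u +
      \sum_(y <- s) a y * (F (p y) * (u == q y)%:R - F (q y) * (u == p y)%:R)) k.
  move=> h1; elim: s => [|y s IHs].
    by apply: eq_acyclic h1 => u; rewrite big_nil addr0.
  have := acyclic_move (a := a y) (hact (p y)) (hact (q y)) IHs.
  by apply: eq_acyclic => u; rewrite big_cons -addrA [X in _ + X]addrC.
have h1 : acyclic_above K (fun u => c u +
    \sum_i \sum_k g i k * (f0 i * (u == inr k)%:R - x0 k * (u == inl i)%:R)) k.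
  have := moves _ (enum {: 'I_n * 'I_e}) (fun y => g y.1 y.2)
    (fun y => inl y.1) (fun y => inr y.2) _ hK.
  by apply: eq_acyclic => u; rewrite big_enum pair_big.
(* Each pair enters once, with [j < k], so that all of the alternating [B] is removed without
   halving. *)
have h2 : acyclic_above K (fun u => c u +
    \sum_i \sum_k g i k * (f0 i * (u == inr k)%:R - x0 k * (u == inl i)%:R) +
    \sum_(j < e) \sum_(k < e) (if (j < k)%N then - B k j else 0) *
      (x0 j * (u == inr k)%:R - x0 k * (u == inr j)%:R)) k.
  have := moves _ (enum {: 'I_e * 'I_e}) (fun y => if (y.1 < y.2)%N then - B y.2 y.1 else 0)
    (fun y => inr y.1) (fun y => inr y.2) _ h1.
  by apply: eq_acyclic => u; rewrite big_enum; congr (_ + _); rewrite pair_big.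
apply: (acyclic_zero (K := K) (k := k) m1); apply: eq_acyclic h2 => u /=.
case: u => [i|l] /=.
  rewrite [X in _ + X]big1 ?addr0; last first.
    by move=> j _; rewrite big1 // => l _; rewrite !mulr0 subrr mulr0.
  rewrite (bigD1 i) //= [X in _ + (_ + X)]big1 ?addr0; last first.
    move=> j hj; rewrite big1 // => l _.
    by rewrite (inj_eq (@inl_inj _ _)) eq_sym (negPf hj) !mulr0 subrr mulr0.
  rewrite hg -big_split big1 //= => l _.
  by rewrite eqxx /= mulr1n; ring.
rewrite add0r exchange_big /= (bigD1 l) //= [X in _ + X + _]big1 ?addr0; last first.
  move=> j hj; rewrite big1 // => i _.
  by rewrite (inj_eq (@inr_inj _ _)) eq_sym (negPf hj) !mulr0 subrr mulr0.
rewrite (eq_bigr (fun i => g i l * f0 i)); last by move=> i _; rewrite eqxx /= mulr1n; ring.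
rewrite hB.
under [X in _ + X]eq_bigr do under eq_bigr do rewrite mulrBr.
under [X in _ + X]eq_bigr do rewrite sumrB.
rewrite sumrB.
rewrite [X in _ + (X - _)](_ : _ = \sum_(j < e) (if (j < l)%N then - B l j else 0) * x0 j).
  rewrite [X in _ + (_ - X)](_ : _ = \sum_(j < e) (if (l < j)%N then - B j l else 0) * x0 j).
    rewrite -sumrB -big_split big1 //= => j _.
    case: (ltngtP j l) => [h|h|/val_inj ->]; last by rewrite hB0; ring.
      by ring.
    by rewrite (hBN j l); ring.
  rewrite (bigD1 l) //= [X in _ + X]big1 ?addr0; last first.
    move=> j hj; rewrite big1 // => i _.
    by rewrite (inj_eq (@inr_inj _ _)) eq_sym (negPf hj) !mulr0.
  by apply: eq_bigr => j _; rewrite eqxx mulr1.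
rewrite exchange_big (bigD1 l) //= [X in _ + X]big1 ?addr0; last first.
  move=> j hj; rewrite big1 // => i _.
  by rewrite (inj_eq (@inr_inj _ _)) eq_sym (negPf hj) !mulr0.
by apply: eq_bigr => j _; rewrite eqxx mulr1.
Qed.

End Base.

(** * Minimal generators *)

Section MinGen.
Variables (R : comUnitRingType) (m : R -> Prop).
Hypothesis hm : local_max m.
Implicit Types (A B : R -> Prop).

Let mP : is_prime m := local_prime hm.
Let mI : is_ideal m := prime_ideal mP.

(** The product ideal as an intersection, so that an inclusion is proved by naming a target
    ideal. *)
Definition iprod A B : R -> Prop := fun x => forall C, is_ideal C ->
  (forall u v, A u -> B v -> C (u * v)) -> C x.

Lemma iprod_ideal A B : is_ideal (iprod A B).
Proof.
split; [|split] => [C hC _|x y hx hy C hC h|r x hx C hC h]; first exact: ideal0.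
  by apply: idealD; [|exact: hx|exact: hy].
by apply: idealMl => //; apply: hx.
Qed.

Lemma iprod_mem A B u v : A u -> B v -> iprod A B (u * v).
Proof. by move=> hu hv C _; apply. Qed.

Lemma iprod_incl A B : is_ideal B -> incl (iprod A B) B.
Proof. by move=> hB x h; apply: h => // u v _; apply: idealMl. Qed.

Lemma iprod_gen A B n (g : 'I_n -> R) x : is_ideal A -> incl B (span g) -> iprod A B x ->
  exists2 c : 'I_n -> R, (forall i, A (c i)) & x = \sum_i c i * g i.
Proof.
move=> hA hg h; apply: (h (fun x => exists2 c : 'I_n -> R, (forall i, A (c i)) &
  x = \sum_i c i * g i)).
  split; [|split].
  - by exists (fun=> 0) => [i|]; [exact: ideal0|rewrite big1 // => i _; rewrite mul0r].
  - move=> _ _ [c hc ->] [d hd ->]; exists (fun i => c i + d i) => [i|]; first exact: idealD.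
    by rewrite -big_split; apply: eq_bigr => i _; rewrite mulrDl.
  - move=> r _ [c hc ->]; exists (fun i => r * c i) => [i|]; first exact: idealMl.
    by rewrite big_distrr; apply: eq_bigr => i _; rewrite /= mulrA.
move=> u v hu /hg [c ->]; exists (fun i => u * c i) => [i|]; first exact: idealMr.
by rewrite big_distrr; apply: eq_bigr => i _; rewrite /= mulrA.
Qed.

Lemma iprodC A B x : iprod A B x -> iprod B A x.
Proof. by move=> h C hC hBA; apply: h => // u v hu hv; rewrite mulrC; apply: hBA. Qed.

(** For [g] in [A]: linear independence of the classes in [A/mA] over the residue field. *)
Definition indep A p (g : 'I_p -> R) :=
  forall c : 'I_p -> R, iprod m A (\sum_i c i * g i) -> forall i, m (c i).

Lemma min_gen_indep A N (g : 'I_N -> R) : is_ideal A -> nu_is A N -> generated_by A g ->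
  indep A g.
Proof.
move=> hA [_ hmin] hg c hc i0; apply: contrapT => hci0.
have [d hd e] := iprod_gen mI (fun x hx => (hg x).1 hx) hc.
case: N g hmin hg c hc i0 hci0 d hd e => [|N] g hmin hg c hc i0 hci0 d hd e; first by have := ltn_ord i0.
have hu : c i0 - d i0 \is a GRing.unit.
  by apply: (local_unit hm) => h; apply: hci0; apply: (idealBK mI h).
suff : (N.+1 <= N)%N by rewrite ltnn.
apply: (hmin N (fun k => g (lift i0 k))); apply: generatedP => //.
  by move=> k; apply: (generated_mem _ hg).
move=> x /hg; apply: span_incl; first exact: span_ideal.
move=> i; case: (unliftP i0 i) => [k|] ->; first exact: (span_mem (fun k => g (lift i0 k))).
apply: (ideal_unit (span_ideal _) hu).
have -> : (c i0 - d i0) * g i0 = \sum_(i | i != i0) (d i - c i) * g i.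
  move: e; rewrite (bigD1 i0) //= [X in _ = X](bigD1 i0) //= => e.
  under eq_bigr do rewrite mulrBl.
  rewrite sumrB mulrBl; apply/eqP.
  by rewrite subr_eq addrAC eq_sym subr_eq e addrC.
apply: ideal_sum; first exact: span_ideal.
move=> j; case: (unliftP i0 j) => [k|] ->; last by rewrite eqxx.
move=> _; apply: idealMl; first exact: span_ideal.
exact: (span_mem (fun k => g (lift i0 k))).
Qed.

(** Gaussian elimination over the residue field, carried out on representatives; an entry outside
    [m] is the pivot. *)
Lemma residue_dependent M p (C : 'I_p -> 'I_M -> R) : (M < p)%N ->
  exists v : 'I_p -> R, (exists i, ~ m (v i)) /\ forall j, m (\sum_i v i * C i j).
Proof.
elim: M p C => [|M IH] p C hp.
  exists (fun=> 1); split; last by case.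
  by exists (Ordinal hp); apply: prime1.
have [hall|hno] := EM (forall i, m (C i ord0)).
  have [v [hv1 hv2]] := IH p (fun i j => C i (lift ord0 j)) (ltnW hp).
  exists v; split=> // j; case: (unliftP ord0 j) => [k|] ->; first exact: hv2.
  by apply: ideal_sum => // i _; apply: idealMl.
have [i0 hi0] : exists i0, ~ m (C i0 ord0).
  by apply: contrapT => h; apply: hno => i; apply: contrapT => hi; apply: h; exists i.
have hu := local_unit hm hi0.
case: p C hp hno i0 hi0 hu => // p C hp hno i0 hi0 hu.
set w := (C i0 ord0)^-1.
have [v [[k hk] hv2]] := IH p (fun k j => C (lift i0 k) (lift ord0 j) -
   C (lift i0 k) ord0 * w * C i0 (lift ord0 j)) hp.
pose v0 := - \sum_k v k * C (lift i0 k) ord0 * w.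
pose V i := if unlift i0 i is Some k then v k else v0.
have Vl k' : V (lift i0 k') = v k' by rewrite /V liftK.
have V0 : V i0 = v0 by rewrite /V unlift_none.
have hsum (G : 'I_p.+1 -> R) : \sum_i V i * G i = v0 * G i0 + \sum_k v k * G (lift i0 k).
  by rewrite (bigD1_ord i0) //= V0; congr (_ + _); apply: eq_bigr => k' _; rewrite Vl.
exists V; split; first by exists (lift i0 k); rewrite Vl.
move=> j; rewrite hsum /v0 mulNr big_distrl /= addrC -sumrB.
case: (unliftP ord0 j) => [l|] ->.
  by have := hv2 l; congr m; apply: eq_bigr => k' _; ring.
rewrite big1; first exact: ideal0.
by move=> k' _; rewrite -!mulrA mulVr // mulr1 subrr.
Qed.

Lemma indep_size A M (h : 'I_M -> R) p (g : 'I_p -> R) : is_ideal A -> generated_by A h ->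
  (forall i, A (g i)) -> indep A g -> (p <= M)%N.
Proof.
move=> hA hh hgA hg; rewrite leqNgt; apply/negP => hMp.
have ex i : exists c : 'I_M -> R, g i = \sum_j c j * h j by apply/hh.
have [C hC] := choice ex.
have [v [[i hi] hv]] := residue_dependent C hMp.
apply: hi; apply: (hg v).
have -> : \sum_i v i * g i = \sum_j (\sum_i v i * C i j) * h j.
  under eq_bigr do rewrite hC big_distrr.
  rewrite exchange_big; apply: eq_bigr => j _ /=; rewrite big_distrl.
  by apply: eq_bigr => k _; rewrite mulrA.
apply: (ideal_sum _ (iprod_ideal m A)) => j _.
by apply: iprod_mem; [exact: hv|exact: (generated_mem _ hh)].
Qed.

Definition indep2 A r p (s : 'I_r -> R) (t : 'I_p -> R) :=
  forall c d, iprod m A (\sum_i c i * s i + \sum_j d j * t j) ->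
  (forall i, m (c i)) /\ (forall j, m (d j)).

Lemma indep2_size A N r p (s : 'I_r -> R) (t : 'I_p -> R) :
  is_ideal A -> nu_is A N -> (forall i, A (s i)) -> (forall j, A (t j)) ->
  incl A (iadd (span s) (span t)) -> indep2 A s t -> N = (r + p)%N.
Proof.
move=> hA [[h hh] hmin] hs ht hgen hind.
pose st (i : 'I_(r + p)) := match split i with inl a => s a | inr b => t b end.
have stl i : st (lshift p i) = s i by rewrite /st -[lshift p i]/(unsplit (inl i)) unsplitK.
have str j : st (rshift r j) = t j by rewrite /st -[rshift r j]/(unsplit (inr j)) unsplitK.
have hst i : A (st i) by rewrite /st; case: split.
apply/eqP; rewrite eqn_leq; apply/andP; split.
  apply: (hmin _ st); apply: generatedP => // x /hgen.
  apply: iadd_incl; first exact: span_ideal.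
    by apply: span_incl; [exact: span_ideal|move=> i; rewrite -stl; apply: span_mem].
  by apply: span_incl; [exact: span_ideal|move=> i; rewrite -str; apply: span_mem].
apply: (indep_size hA hh hst) => c.
rewrite big_split_ord /=.
under eq_bigr do rewrite stl.
under [X in _ + X]eq_bigr do rewrite str.
move=> /hind [h1 h2] i; rewrite -(splitK i); case: (split i) => k; [exact: h1|exact: h2].
Qed.

(** Basis extension in [A/mA]: [indep_size] bounds the number of steps, and by Nakayama a family
    that cannot be extended generates [A]. *)
Lemma indep_extend A N r (s : 'I_r -> R) : is_ideal A -> nu_is A N ->
  (forall i, A (s i)) -> indep A s ->
  exists p (t : 'I_p -> R), [/\ forall j, A (t j), incl A (iadd (span s) (span t)) &
    indep2 A s t].
Proof.
move=> hA hnu; have [[h hh] _] := hnu.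
have [k] := ubnP (N - r); elim: k r s => // k IH r s hk hs hind.
have hsi := span_ideal s.
have [hgen|hngen] := EM (incl A (span s)).
  exists 0%N, (fun=> 0); split=> //.
    by case.
    by move=> x /hgen; apply/iaddl/span_ideal.
  by move=> c d; rewrite big_ord0 addr0 => /hind h1; split=> // -[].
have [t0 ht0 ht0s] : exists2 t0, A t0 & ~ iadd (span s) (iprod m A) t0.
  apply: contrapT => hn; apply: hngen.
  have [i|u hu hus] := @nakayama_prime R m (span s) N h mP hsi.
    have [a [b [ha hb e]]] : iadd (span s) (iprod m A) (h i).
      by apply: contrapT => hh'; apply: hn; exists (h i) => //; apply: (generated_mem _ hh).
    have [c hc ec] := iprod_gen mI (fun x hx => (hh x).1 hx) hb.
    exists 1, c; split=> //; first exact: prime1.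
    by rewrite mul1r e -ec addrK.
  move=> x /hh; apply: span_incl => // i.
  exact: (ideal_unit hsi (local_unit hm hu)).
have hind' : indep A (ocons t0 s).
  move=> c; rewrite big_ord_recl ocons0; under eq_bigr do rewrite oconsS.
  move=> hc.
  have hc0 : m (c ord0).
    apply: contrapT => /(local_unit hm) hu; apply: ht0s.
    apply: (ideal_unit (iadd_ideal hsi (iprod_ideal m A)) hu).
    exists (- \sum_i c (lift ord0 i) * s i), (c ord0 * t0 + \sum_i c (lift ord0 i) * s i).
    split=> //; last by rewrite addrC addrK.
    by apply: idealN => //; exists (fun i => c (lift ord0 i)).
  have /hind h1 : iprod m A (\sum_i c (lift ord0 i) * s i).
    rewrite -(addKr (c ord0 * t0) (\sum_i _)) addrC.
    by apply: (idealB (iprod_ideal m A)) => //; apply: iprod_mem.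
  by move=> i; case: (unliftP ord0 i) => [j|] ->.
have hs' i : A (ocons t0 s i) by rewrite /ocons; case: unlift.
have hrN := indep_size hA hh hs' hind'.
have [|p [t [ht hgen hi2]]] := IH _ (ocons t0 s) _ hs' hind'.
  by move: hk hrN; lia.
exists p.+1, (ocons t0 t); split.
- by move=> j; rewrite /ocons; case: unlift.
- have hT : is_ideal (iadd (span s) (span (ocons t0 t))).
    by apply: iadd_ideal => //; apply: span_ideal.
  move=> x /hgen; apply: (iadd_incl hT); apply: span_incl => // i.
    case: (unliftP ord0 i) => [j|] ->; rewrite ?ocons0 ?oconsS.
      by apply: iaddl; [exact: span_ideal|exact: span_mem].
    by apply: iaddr => //; have := span_mem (ocons t0 t) ord0; rewrite ocons0.
  by apply: iaddr => //; have := span_mem (ocons t0 t) (lift ord0 i); rewrite oconsS.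
move=> c d; rewrite [X in _ + X]big_ord_recl ocons0.
under [X in _ + (_ + X)]eq_bigr do rewrite oconsS.
move=> hcd.
have [|h1 h2] := hi2 (ocons (d ord0) c) (fun j => d (lift ord0 j)).
  rewrite big_ord_recl !ocons0; under eq_bigr do rewrite !oconsS.
  by move: hcd; rewrite addrCA addrA.
split=> [i|j]; first by have := h1 (lift ord0 i); rewrite oconsS.
case: (unliftP ord0 j) => [l|] ->; first exact: h2.
by have := h1 ord0; rewrite ocons0.
Qed.
End MinGen.

(** * Transfer along the surjection from Q to R *)

Section Surjection.
Variables (Q R : comUnitRingType) (pi : {rmorphism Q -> R}).
Hypothesis surj : forall y : R, exists x, pi x = y.

Lemma img_ideal J : is_ideal J -> is_ideal (img pi J).
Proof.
move=> hJ; split; [|split].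
- by exists 0; rewrite rmorph0; split=> //; apply: ideal0.
- move=> _ _ [x [hx <-]] [y [hy <-]]; exists (x + y); rewrite rmorphD; split=> //.
  exact: idealD.
- move=> r _ [x [hx <-]]; have [s <-] := surj r.
  by exists (s * x); rewrite rmorphM; split=> //; apply: idealMl.
Qed.

Lemma preim_ideal (B : R -> Prop) : is_ideal B -> is_ideal (fun x => B (pi x)).
Proof.
move=> hB; split; [by rewrite rmorph0; apply: ideal0|split].
  by move=> x y hx hy; rewrite rmorphD; apply: idealD.
by move=> r x hx; rewrite rmorphM; apply: idealMl.
Qed.

Lemma noetherian_img : noetherian Q -> noetherian R.
Proof.
move=> hN I hI; have [n [g hg]] := hN _ (preim_ideal hI).
exists n, (fun i => pi (g i)); apply: generatedP => //.
  by move=> i; apply: (generated_mem i hg).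
move=> y hy; have [x ex] := surj y.
have /hg [c hc] : I (pi x) by rewrite ex.
exists (fun i => pi (c i)); rewrite -ex hc rmorph_sum.
by apply: eq_bigr => i _; rewrite rmorphM.
Qed.

Variables (nn : Q -> Prop).
Hypothesis hnn : local_max nn.
Hypothesis kern : forall x, pi x = 0 -> nn x.

Lemma img_local_mem x : img pi nn (pi x) -> nn x.
Proof.
have nI := hnn.1; move=> [y [hy e]]; rewrite -(subrK y x); apply: idealD => //.
by apply: kern; rewrite rmorphB e subrr.
Qed.

Lemma img_local : local_max (img pi nn).
Proof.
split; first exact: img_ideal hnn.1.
move=> y; have [x <-] := surj y; split.
  move=> /img_local_mem hx; apply/negP => hu.
  have [v ev] := surj (pi x)^-1.
  apply: (prime1 (local_prime hnn)); apply: img_local_mem.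
  exists (x * v); rewrite rmorphM ev mulrV // rmorph1; split=> //.
  by apply: idealMr => //; apply: hnn.1.
move=> hu; exists x; split=> //; apply: contrapT => /(local_unit hnn) h.
by move: hu; rewrite rmorph_unit.
Qed.

Lemma img_iprod A B x : iprod A B x -> iprod (img pi A) (img pi B) (pi x).
Proof.
move=> h C hC hAB; apply: (h (fun x => C (pi x))); first exact: preim_ideal.
by move=> u v hu hv; rewrite rmorphM; apply: hAB; [exists u|exists v].
Qed.

Lemma dif_map n (f : 'I_n -> Q) (x : kff Q n) (y : kff R n) :
  (forall U, pi (x U) = y U) -> forall U, pi (dif f x U) = dif (fun p => pi (f p)) y U.
Proof.
move=> h U; rewrite /dif !sum_ffunE rmorph_sum; apply: eq_bigr => p _.
rewrite !ffunE /GRing.scale /= rmorphM; congr (_ * _); case: ifP => _; first exact: rmorph0.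
by rewrite rmorphM h /sgn rmorph_sign.
Qed.
End Surjection.

Lemma kdeg1_op (R : comUnitRingType) r (s : kff R r) : @kdeg R r 1 s ->
  s = op (fun j => s [set j]) (vac R r).
Proof.
move=> hs; apply/ffunP => U; have [/cards1P [j ->]|hU] := boolP (#|U| == 1%N).
  by rewrite op_vac.
by rewrite hs // (@op_deg _ _ _ 0) //; apply: vac_deg.
Qed.

Lemma zcomb_vac (R : comUnitRingType) n r (c : 'I_r -> 'I_n -> R) :
  zcomb c (vac R r) = vac R n.
Proof.
rewrite /zcomb (bigD1 set0) //= big1 ?addr0 => [|U hU].
  by rewrite enum_set0 /= ffunE /kone eqxx scale1r.
by rewrite ffunE /kone (negPf hU) scale0r.
Qed.

(** * Counting the generators of a and J *)

Section Main.
Variables (Q : comUnitRingType) (nn a J : Q -> Prop).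
Variables (R : comUnitRingType) (pi : {rmorphism Q -> R}).
Hypothesis hreg : regular_local nn.
Hypothesis haI : is_ideal a.
Hypothesis surj : forall y : R, exists x, pi x = y.
Hypothesis ker : forall x, pi x = 0 <-> a x.
Hypothesis hJI : is_ideal J.
Hypothesis haJ : incl a J.
Hypothesis hJn : incl J nn.

Variables (n : nat) (ft : 'I_n -> Q).
Hypothesis ftJ : forall p, J (ft p).
Let f (p : 'I_n) : R := pi (ft p).
Hypothesis fgen : generated_by (img pi J) f.
Hypothesis fnu : nu_is (img pi J) n.

Variables (r : nat) (z : 'I_r -> kelt R n).
Hypothesis hz : forall j, kcycle f 1 (z j).
Hypothesis hspan : forall i c, kcycle f i c -> exists s : {set 'I_r} -> R,
           kboundary f i (fun V => c V - kcomb i z s V).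
Hypothesis hfree : forall i (s : {set 'I_r} -> R), kboundary f i (kcomb i z s) ->
         forall U : {set 'I_r}, #|U| = i -> span f (s U).

Variable ct : 'I_r -> 'I_n -> Q.
Hypothesis ctE : forall j p, pi (ct j p) = zcoef z j p.
Let s (j : 'I_r) : Q := \sum_p ct j p * ft p.

Let hnn : local_max nn := hreg.2.1.
Let hnP : is_prime nn := local_prime hnn.
Let hnI : is_ideal nn := prime_ideal hnP.
Let han : incl a nn := fun x hx => hJn (haJ hx).
Let kern x : pi x = 0 -> nn x := fun h => han ((ker x).1 h).
Let hmR : local_max (img pi nn) := img_local surj hnn kern.

Lemma syzygy_value_mem j : a (s j).
Proof.
apply/ker; rewrite rmorph_sum -[RHS](zcoef_cycle hz j).
by apply: eq_bigr => p _; rewrite rmorphM ctE.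
Qed.

Lemma lift_gen_indep : indep (img pi nn) (img pi J) f.
Proof. by apply: min_gen_indep => //; apply: img_ideal. Qed.

(** The computation takes place in [Q], where the Koszul complex on [y] is exact in degree 1; its
    error terms [al] lie in [a] and vanish in [R]. *)
Lemma syzygy_value_indep : indep nn a s.
Proof.
move=> u hu j0; apply: contrapT => /(local_unit hnn) hu0.
have [e [y [hy hK]]] := regular_local_koszul hreg.
(* The product is expanded over the generators of [nn], so the coefficients lie in [a]. *)
have [al hal eal] := iprod_gen haI (fun x hx => (hy x).1 hx) (iprodC hu).
have exA p : exists A : 'I_e -> Q, ft p = \sum_k A k * y k by apply/hy/hJn.
have [A hA] := choice exA.
pose c p := \sum_j u j * ct j p.
have ec : \sum_p c p * ft p = \sum_k al k * y k.
  rewrite -eal /c; under eq_bigr do rewrite big_distrl.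
  rewrite exchange_big; apply: eq_bigr => j _ /=; rewrite /s big_distrr.
  by apply: eq_bigr => p _ /=; rewrite mulrA.
have epc p : pi (c p) = \sum_j pi (u j) * zcoef z j p.
  by rewrite /c rmorph_sum; apply: eq_bigr => j _; rewrite rmorphM ctE.
have epcf : \sum_p pi (c p) * f p = 0.
  transitivity (pi (\sum_p c p * ft p)).
    by rewrite rmorph_sum; apply: eq_bigr => p _; rewrite rmorphM.
  apply/ker; rewrite ec; apply: ideal_sum => // k _; exact: idealMr.
(* [c] reduces to a syzygy of the minimal generators [f]. *)
have cn p : nn (c p).
  apply: (img_local_mem hnn kern); apply: (lift_gen_indep (c := fun p => pi (c p))).
  by rewrite epcf; apply: ideal0; apply: iprod_ideal.
have exG p : exists G : 'I_e -> Q, c p = \sum_k G k * y k by apply/hy.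
have [G hG] := choice exG.
have [B0 hB0 eB0] : exists2 B0, alternating B0 &
    forall k, \sum_p c p * A p k - al k = \sum_j B0 k j * y j.
  have [|B0 h1 h2] := hK (fun k => \sum_p c p * A p k - al k).
    under eq_bigr do rewrite mulrBl.
    rewrite sumrB -ec; apply/eqP; rewrite subr_eq0; apply/eqP.
    under eq_bigr do rewrite big_distrl.
    rewrite exchange_big; apply: eq_bigr => p _ /=; rewrite hA big_distrr.
    by apply: eq_bigr => k _; rewrite /= mulrA.
  by exists B0 => // k; apply/eqP; rewrite -subr_eq0; apply/eqP/h2.
(* Applied to [y], the first part gives [\sum_p G p k * ft p - \sum_p c p * A p k]; adding [B0]
   turns this into [\sum_p G p k * ft p - al k]. *)
pose B k j := \sum_p (G p k * A p j - G p j * A p k) + B0 k j.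
have exact0 i (x w : kff R n) := @qci_exact R n f r z hz hspan hfree
  (fun j => pi (u j)) j0 i x w (rmorph_unit pi hu0).
apply: (@koszul_boundary_absurd R (img pi nn) n e f (fun k => pi (y k)) hmR.1 _
   (fun p => \sum_j pi (u j) * zcoef z j p) _ exact0
   (fun p k => pi (G p k)) (fun k j => pi (B k j))).
- by move=> p; exists (ft p); split=> //; apply: hJn.
- by under eq_bigr do rewrite -epc.
- exact: prime1 (local_prime hmR).
- by move=> k; exists (y k); split=> //; apply: (generated_mem _ hy).
- move=> p; rewrite -epc hG rmorph_sum; apply: eq_bigr => k _; exact: rmorphM.
- split=> [k|k j]; rewrite /B.
    by rewrite hB0.1 big1 ?addr0 ?rmorph0 // => p _; rewrite subrr.
  rewrite -rmorphN (hB0.2 k j) opprD -sumrN; congr (pi (_ - _)).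
  by apply: eq_bigr => p _; rewrite opprB.
move=> k.
transitivity (pi (\sum_p G p k * ft p)).
  by rewrite rmorph_sum; apply: eq_bigr => p _; rewrite rmorphM.
transitivity (pi (\sum_j B k j * y j)); last first.
  by rewrite rmorph_sum; apply: eq_bigr => j _; rewrite rmorphM.
apply/eqP; rewrite -subr_eq0 -rmorphB; apply/eqP/ker.
suff -> : \sum_p G p k * ft p - \sum_j B k j * y j = al k by [].
have e1 : \sum_j B k j * y j = \sum_j (\sum_p G p k * A p j * y j) -
    \sum_j (\sum_p G p j * A p k * y j) + \sum_j B0 k j * y j.
  rewrite -sumrB -big_split; apply: eq_bigr => j _ /=.
  rewrite /B mulrDl big_distrl -sumrB; congr (_ + _).
  by apply: eq_bigr => p _; rewrite /= mulrBl.
rewrite e1 -eB0 [X in _ - (X - _ + _)]exchange_big [X in _ - (_ - X + _)]exchange_big /=.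
rewrite [X in _ - (X - _ + _)](eq_bigr (fun p => G p k * ft p)); last first.
  by move=> p _; rewrite hA big_distrr; apply: eq_bigr => j _; rewrite /= mulrA.
rewrite [X in _ - (_ - X + _)](eq_bigr (fun p => c p * A p k)); last first.
  move=> p _; rewrite hG big_distrl; apply: eq_bigr => j _.
  by rewrite /= mulrAC.
by ring.
Qed.

Lemma generators_size nJ na : nu_is J nJ -> nu_is a na ->
  exists p, na = (r + p)%N /\ nJ = (n + p)%N.
Proof.
move=> hnuJ hnua.
have [p [t [hta hgen hind]]] := indep_extend hnn haI hnua syzygy_value_mem syzygy_value_indep.
exists p; split; first exact: (indep2_size hnn haI hnua syzygy_value_mem hta hgen hind).
have hft : is_ideal (span ft) by apply: span_ideal.
have hJdec x : J x -> exists h : 'I_n -> Q, a (x - \sum_p h p * ft p).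
  move=> hx; have /fgen [b eb] : img pi J (pi x) by exists x.
  have exb p' : exists q, pi q = b p' by apply: surj.
  have [h hh] := choice exb; exists h; apply/ker.
  rewrite rmorphB eb rmorph_sum; apply/eqP; rewrite subr_eq0; apply/eqP.
  by apply: eq_bigr => q _; rewrite rmorphM hh.
apply: (indep2_size (t := t) hnn hJI hnuJ ftJ).
- by move=> j; apply: haJ; apply: hta.
- move=> x /hJdec [h hx].
  have hT : is_ideal (iadd (span ft) (span t)) by apply: iadd_ideal => //; apply: span_ideal.
  apply: (idealBK hT); last first.
    by apply: (iaddl (span_ideal t)); exists h.
  move: hx => /hgen; apply: (iadd_incl hT); last by apply: iaddr.
  by apply: span_incl => // j; apply: (iaddl (span_ideal t)); exists (ct j).
move=> b d hbd; split.
  move=> i; apply: (img_local_mem hnn kern).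
  apply: (lift_gen_indep (c := fun p => pi (b p))).
  suff -> : \sum_i pi (b i) * f i = pi (\sum_i b i * ft i + \sum_j d j * t j).
    exact: (img_iprod hbd).
  rewrite rmorphD !rmorph_sum [X in _ + X]big1 ?addr0; last first.
    by move=> j _; rewrite rmorphM (_ : pi (t j) = 0) ?mulr0 //; apply/ker.
  by apply: eq_bigr => q _; rewrite rmorphM.
(* As [J] is [a] plus the ideal of [ft], an element of [nn J] is a combination of [ft] with
   coefficients in [nn], up to [nn a]. *)
have [b' [al [hb' hal eal]]] : exists b' al, [/\ forall i, nn (b' i), iprod nn a al &
    \sum_i b i * ft i + \sum_j d j * t j = \sum_i b' i * ft i + al].
  apply: (hbd (fun x => exists b' al, [/\ forall i, nn (b' i), iprod nn a al &
    x = \sum_i b' i * ft i + al])).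
    split; [|split].
    - exists (fun=> 0), 0; split=> [i||]; [exact: ideal0|exact: ideal0 (iprod_ideal nn a)|].
      by rewrite big1 ?addr0 // => i _; rewrite mul0r.
    - move=> _ _ [b1 [a1 [h1 h2 ->]]] [b2 [a2 [h3 h4 ->]]].
      exists (fun i => b1 i + b2 i), (a1 + a2); split=> [i||].
      + exact: idealD.
      + exact: (idealD (iprod_ideal nn a)).
      + by rewrite addrACA -big_split; congr (_ + _); apply: eq_bigr => i _; rewrite mulrDl.
    - move=> q _ [b1 [a1 [h1 h2 ->]]]; exists (fun i => q * b1 i), (q * a1); split=> [i||].
      + exact: idealMl.
      + exact: (idealMl _ (iprod_ideal nn a)).
      + by rewrite mulrDr big_distrr; congr (_ + _); apply: eq_bigr => i _; rewrite /= mulrA.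
  move=> u v hu /hJdec [h hv]; exists (fun i => u * h i), (u * (v - \sum_i h i * ft i)).
  split=> [i||]; [exact: idealMr|exact: iprod_mem|].
  rewrite mulrBr big_distrr /=; under eq_bigr do rewrite -mulrA.
  by rewrite addrC subrK.
pose e i := b i - b' i.
have ee : \sum_i e i * ft i + \sum_j d j * t j = al.
  under eq_bigr do rewrite mulrBl.
  by rewrite sumrB addrAC eal addrAC subrr add0r.
have epi : \sum_i pi (e i) * f i = 0.
  transitivity (pi (\sum_i e i * ft i)).
    by rewrite rmorph_sum; apply: eq_bigr => i _; rewrite rmorphM.
  apply/ker; rewrite -(addrK (\sum_j d j * t j) (\sum_i _)) ee.
  apply: idealB => //; first exact: (iprod_incl haI hal).
  by apply: ideal_sum => // j _; apply: idealMl.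
have [||s1 [Y [hs1 hY eY]]] := @qci_span R n f r z hz hspan 1
    (op (fun p => pi (e p)) (vac R n)).
- by apply: op_deg; apply: vac_deg.
- have := dif_op f (fun p => pi (e p)) (vac R n).
  by rewrite epi scale0r dif_vac linear0 addr0.
have exv j : exists q, pi q = s1 [set j] by apply: surj.
have [v hv] := choice exv.
have exY U : exists q, pi q = Y U by apply: surj.
have [Yt0 hYt0] := choice exY.
pose Yt : kff Q n := [ffun U => Yt0 U : Q^o].
have hYt U : pi (Yt U) = Y U by rewrite ffunE hYt0.
(* The rest of [e] after lifting its expression through the cycles and a boundary; it vanishes in
   [R]. *)
pose be q := e q - \sum_j v j * ct j q - (dif ft Yt [set q] : Q).
have hbe q : a (be q).
  apply/ker; rewrite 2!rmorphB rmorph_sum (dif_map ft hYt) -/f.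
  have := congr1 (fun x : kff R n => x [set q]) eY; rewrite op_vac ffunE => ->.
  rewrite {1}(kdeg1_op hs1) zcomb_op zcomb_vac op_vac.
  rewrite [X in X + _ - _ - _](_ : _ = \sum_j pi (v j * ct j q)).
    by rewrite [X in X - _ - _]addrC addrK subrr.
  by apply: eq_bigr => j _; rewrite rmorphM hv ctE.
have esum : \sum_i e i * ft i = \sum_j v j * s j + \sum_i be i * ft i.
  (* The lifted boundary has value 0 at [ft] in [Q] itself. *)
  have h0 : \sum_i (dif ft Yt [set i] : Q) * ft i = 0.
    have := congr1 (fun x : kff Q n => x set0) (dif_dif ft Yt).
    rewrite dif_set0 ffunE => h; rewrite -[RHS]h.
    by apply: eq_bigr => i _; rewrite mulrC.
  have h1 : \sum_j v j * s j = \sum_i (\sum_j v j * ct j i) * ft i.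
    rewrite /s; under eq_bigr do rewrite big_distrr.
    rewrite exchange_big; apply: eq_bigr => i _ /=; rewrite big_distrl.
    by apply: eq_bigr => j _ /=; rewrite mulrA.
  rewrite h1 -[RHS]addr0 -[X in _ = _ + X]h0 -!big_split; apply: eq_bigr => i _ /=.
  by rewrite /be; ring.
apply: (hind v d _).2.
have -> : \sum_j v j * s j + \sum_j d j * t j = al - \sum_i be i * ft i.
  by rewrite -ee esum; ring.
apply: (idealB (iprod_ideal nn a) hal); apply: (ideal_sum _ (iprod_ideal nn a)) => i _.
by apply: iprodC; apply: iprod_mem => //; apply: hJn.
Qed.

End Main.

Theorem theorem1p8 (Q : comUnitRingType) (nn a J : Q -> Prop)
    (R : comUnitRingType) (pi : {rmorphism Q -> R}) :
  regular_local nn ->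
  is_ideal a ->
  (forall x, a x -> ideal_sq nn x) ->
  (forall y : R, exists x, pi x = y) ->
  (forall x, pi x = 0 <-> a x) ->
  is_ideal J ->
  (forall x, a x -> J x) ->
  (forall x, J x -> nn x) ->
  qci (img pi J) ->
  forall nJ na g : nat,
    nu_is J nJ -> nu_is a na -> grade_is (img pi J) g ->
    nJ = (na + g)%N.
Proof.
move=> hreg haI _ surj ker hJI haJ hJn [n [f [fgen [fnu [r [z [hz hqci]]]]]]].
move=> nJ na g hnuJ hnua hgr.
have exf p : exists x, J x /\ pi x = f p by apply: (generated_mem p fgen).
have [ft hft] := choice exf.
have ef : f = fun p => pi (ft p) by apply: funext => p; case: (hft p).
have ftJ p : J (ft p) := (hft p).1.
clear exf hft; subst f.
set f := (fun p => pi (ft p)) in fgen fnu hz hqci.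
have eI : img pi J = span f by apply: funext => x; apply: propext; apply: fgen.
have exc j : exists c : 'I_n -> Q, forall p, pi (c p) = zcoef z j p.
  have exq p : exists q, pi q = zcoef z j p by apply: surj.
  by have [c hc] := choice exq; exists c.
have [ct hct] := choice exc.
have hsp i := (hqci i).1.
have hfr i : forall s, kboundary f i (kcomb i z s) ->
    forall U : {set 'I_r}, #|U| = i -> span f (s U).
  by rewrite -eI; apply: (hqci i).2.
have [p [-> ->]] : exists p, na = (r + p)%N /\ nJ = (n + p)%N.
  exact: (generators_size hreg haI surj ker hJI haJ hJn ftJ fgen fnu hz hsp hfr hct).
rewrite eI in hgr.
have -> : n = (r + g)%N.
  apply: (qci_grade hz hsp hfr _ _ hgr); first exact: noetherian_img surj hreg.1.
  rewrite -eI => -[x [hx e1]]; apply: (prime1 (local_prime hreg.2.1)).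
  rewrite -(subrK x 1); apply: idealD; first exact: prime_ideal (local_prime hreg.2.1).
    by apply/hJn/haJ/ker; rewrite rmorphB rmorph1 e1 subrr.
  exact: hJn.
lia.
Qed.
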